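(* Let $\nu>-\frac12$, $\alpha,\lambda\in[0,1)$, $\tau\in\mathbb{C}\setminus\{0\}$, $-1\le B<A\le 1$, and let $f\in\mathcal{R}^\tau(A,B)$. If $$(A-B)|\tau|\left\{\lambda S_\nu''(1)+(1-\lambda\alpha+2\lambda)S_\nu'(1)+(1-\alpha)(S_\nu(1)-1)\right\}\le 1-\alpha,$$ then $\mathcal{J}_\nu f\in\mathcal{L}_\lambda(\alpha)$.
   Context: Let $\mathbb{D}=\{z\in\mathbb{C}:|z|<1\}$. $\mathcal{A}$ denotes the class of functions $f$ analytic and univalent (injective) in $\mathbb{D}$, normalized by $f(0)=0$, $f'(0)=1$. For $\nu>-1$ the Bessel-Struve kernel function is the entire function $$S_\nu(z)=\sum_{n\ge 0}c_n(\nu)z^n,\qquad c_n(\nu)=\frac{\Gamma(\nu+1)\,\Gamma\left(\frac{n+1}{2}\right)}{\sqrt{\pi}\,n!\,\Gamma\left(\frac n2+\nu+1\right)} .$$ For $\tau\in\mathbb{C}\setminus\{0\}$ and $-1\le B<A\le1$, $\mathcal{R}^\tau(A,B)$ is the class of functions $f(z)=z+\sum_{n=2}^\infty a_nz^n$ analytic in $\mathbb{D}$ satisfying $$\left|\frac{f'(z)-1}{(A-B)\tau-B[f'(z)-1]}\right|<1\quad\text{for all } z\in\mathbb{D}$$ (in particular the denominator does not vanish). The operator $\mathcal{J}_\nu$ is the Hadamard product (convolution) with $zS_\nu(z)$: for $f(z)=z+\sum_{n=2}^\infty a_nz^n$, $$\mathcal{J}_\nu f(z)=z+\sum_{n=2}^\infty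 c_{n-1}(\nu)a_nz^n .$$ For $0\le\alpha<1$ and $0\le\lambda<1$, $$\mathcal{L}_\lambda(\alpha)=\left\{f\in\mathcal{A}:\ \operatorname{Re}\left(\frac{\lambda z^3f'''(z)+(1+2\lambda)z^2f''(z)+zf'(z)}{zf'(z)+\lambda z^2f''(z)}\right)>\alpha\ \text{ for all } z\in\mathbb{D}\right\},$$ where the quotient is understood to have the value $1$ at $z=0$ (removable singularity). *)

(* Defs.v *)
From Stdlib Require Import Reals Factorial.
From Coquelicot Require Import Coquelicot.

Open Scope R_scope.

(* Euler's integral; only evaluated at x > 0, where it converges. *)
Definition Gamma (x : R) : R :=
  RInt_gen (fun t => Rpower t (x - 1) * exp (- t))
    (at_right 0) (Rbar_locally p_infty).

(* Sum of a complex series, computed on real and imaginary parts; it is the sum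
   whenever the series converges, as for Coquelicot's [Series]. *)
Definition CSeries (u : nat -> C) : C :=
  (Series (fun n => Re (u n)), Series (fun n => Im (u n))).

Definition C_derive_n (f : C -> C) (n : nat) : C -> C := Nat.iter n C_derive f.

Definition taylor_coef (f : C -> C) (n : nat) : C :=
  (C_derive_n f n 0 / INR (fact n))%C.

Definition unit_disc (z : C) : Prop := Cmod z < 1.

Definition analytic_on_disc (f : C -> C) : Prop :=
  forall z : C, unit_disc z -> @ex_derive C_AbsRing C_NormedModule f z.

Definition univalent_on_disc (f : C -> C) : Prop :=
  forall z w : C, unit_disc z -> unit_disc w -> f z = f w -> z = w.

Definition class_A (f : C -> C) : Prop :=
  analytic_on_disc f /\ univalent_on_disc f /\
  f 0%C = 0%C /\ C_derive f 0%C = 1%C.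

Definition bs_coef (nu : R) (n : nat) : R :=
  Gamma (nu + 1) * Gamma ((INR n + 1) / 2) /
  (sqrt PI * INR (fact n) * Gamma (INR n / 2 + nu + 1)).

Definition bessel_struve (nu : R) (z : C) : C :=
  CSeries (fun n => (bs_coef nu n * z ^ n)%C).

Definition class_R (tau : C) (A B : R) (f : C -> C) : Prop :=
  analytic_on_disc f /\
  (exists a : nat -> C,
     a 0%nat = 0%C /\ a 1%nat = 1%C /\
     forall z : C, unit_disc z -> @is_pseries C_AbsRing C_NormedModule a z (f z)) /\
  forall z : C, unit_disc z ->
    let w := (C_derive f z - 1)%C in
    let d := ((A - B)%R * tau - B * w)%C in
    d <> 0%C /\ Cmod (w / d)%C < 1.

(* The sum over n >= 2 of c_{n-1}(nu) a_n z^n, reindexed by n = k + 2. *)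
Definition J_op (nu : R) (f : C -> C) (z : C) : C :=
  (z + CSeries (fun k =>
         bs_coef nu (k + 1) * taylor_coef f (k + 2) * z ^ (k + 2)))%C.

Definition L_num (lambda : R) (f : C -> C) (z : C) : C :=
  (lambda * z ^ 3 * C_derive_n f 3 z
   + (1 + 2 * lambda)%R * z ^ 2 * C_derive_n f 2 z
   + z * C_derive f z)%C.

Definition L_den (lambda : R) (f : C -> C) (z : C) : C :=
  (z * C_derive f z + lambda * z ^ 2 * C_derive_n f 2 z)%C.

(* The value 1 at z = 0 fills the removable singularity. *)
Definition L_quot (lambda : R) (f : C -> C) (z : C) : C :=
  if Ceq_dec z 0%C then 1%C else (L_num lambda f z / L_den lambda f z)%C.

(* L_num is z times the derivative of L_den, so the quotient has a pole at every
   zero z <> 0 of L_den; the non-vanishing clause only makes its definedness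
   explicit. *)
Definition class_L (lambda alpha : R) (f : C -> C) : Prop :=
  class_A f /\
  forall z : C, unit_disc z ->
    (z <> 0%C -> L_den lambda f z <> 0%C) /\ Re (L_quot lambda f z) > alpha.

(* Main.v *)
(* The class condition on f says that w = f' - 1 satisfies |w| < |c - B w| on the disc, with
   c = (A - B) tau; Clunie's method turns this into n |a_n| <= (A - B) |tau|. The coefficients
   e_n of h = z g' + lambda z^2 g'', where g = J_nu f, then satisfy
   sum_{n >= 2} (n - alpha) |e_n| <= 1 - alpha, because the left-hand side of the hypothesis is the
   sum over m >= 1 of (m + 1 - alpha) (1 + lambda m) c_m(nu) (here c_0(nu) = 1, i.e.
   Gamma(1/2) = sqrt pi, is needed). This bound gives |z h' - h| < (1 - alpha) |h| for z <> 0,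
   which is the half-plane condition, and sum_{n >= 2} n |b_n| <= 1 for g, hence univalence. *)

Require Import Defs.
From Stdlib Require Import Reals Factorial Arith Lra Lia.
From Coquelicot Require Import Coquelicot.

Open Scope R_scope.

(** * Absolutely convergent complex series and power series *)

(** The circle averages of Clunie's method are taken over roots of unity instead of by integration.
    Such a mean is exact on polynomials of degree below the number of points, so [PS w] has to be
    truncated first; an inequality affine in [PS w] keeps the truncation error linear and hence
    harmless. The condition nu > -1/2 enters through the decay of c_n(nu). It gives (n + 1)/2 < n/2
    + nu + 1, so the quotient of the two Gamma values is bounded in n and c_n(nu) is at most a
    constant over n!. Thus S_nu converges beyond 1 and can be differentiated there. The same
    condition puts every Gamma argument that occurs in [1/2, infinity), where all estimates can be
    read off Euler's integral with t^(-1/2) as majorant near 0, without the functional equation. The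
    hypothesis and the summed coefficient bound are non-strict. The strict half-plane inequality
    comes from the point: every term from n = 2 on carries |z|^2, and |z|^2 < |z| for 0 < |z| <
    1. *)

Lemma ex_series_le_nonneg (a b : nat -> R) :
  (forall n, 0 <= a n <= b n) -> ex_series b -> ex_series a.
Proof.
  intros H Hb. apply (ex_series_le (K:=R_AbsRing) (V:=R_CompleteNormedModule) a b); [|exact Hb].
  intros n. change (Rabs (a n) <= b n). rewrite Rabs_pos_eq; apply H.
Qed.

Lemma Series_nonneg (a : nat -> R) :
  (forall n, 0 <= a n) -> ex_series a -> 0 <= Series a.
Proof.
  intros H Ha. rewrite <- (Rmult_0_l (Series a)). rewrite <- Series_scal_l.
  apply Series_le; [|exact Ha]. intros n. rewrite Rmult_0_l. split; [lra|apply H].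
Qed.

Lemma ex_series_Rmult_l (c : R) (a : nat -> R) :
  ex_series a -> ex_series (fun n => c * a n).
Proof. apply (ex_series_scal (K:=R_AbsRing) (V:=R_NormedModule) c a). Qed.

Definition abs_summable (u : nat -> C) : Prop := ex_series (fun n => Cmod (u n)).

Lemma im_le_Cmod (c : C) : Rabs (Im c) <= Cmod c.
Proof. eapply Rle_trans; [apply Rmax_r|apply Rmax_Cmod]. Qed.

Lemma abs_summable_Re (u : nat -> C) : abs_summable u -> ex_series (fun n => Re (u n)).
Proof.
  intros H. apply ex_series_Rabs. eapply ex_series_le_nonneg; [|exact H].
  intros n; split; [apply Rabs_pos|apply re_le_Cmod].
Qed.

Lemma abs_summable_Im (u : nat -> C) : abs_summable u -> ex_series (fun n => Im (u n)).
Proof.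
  intros H. apply ex_series_Rabs. eapply ex_series_le_nonneg; [|exact H].
  intros n; split; [apply Rabs_pos|apply im_le_Cmod].
Qed.

Lemma CSeries_ext (u v : nat -> C) : (forall n, u n = v n) -> CSeries u = CSeries v.
Proof.
  intros H. unfold CSeries. f_equal; apply Series_ext; intros n; now rewrite H.
Qed.

Lemma abs_summable_ext (u v : nat -> C) :
  (forall n, u n = v n) -> abs_summable u -> abs_summable v.
Proof. intros H. apply ex_series_ext. intros n; now rewrite H. Qed.

Lemma abs_summable_le (u : nat -> C) (b : nat -> R) :
  (forall n, Cmod (u n) <= b n) -> ex_series b -> abs_summable u.
Proof.
  intros H. apply ex_series_le_nonneg. intros n; split; [apply Cmod_ge_0|apply H].
Qed.

Lemma abs_summable_plus (u v : nat -> C) :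
  abs_summable u -> abs_summable v -> abs_summable (fun n => u n + v n)%C.
Proof.
  intros Hu Hv. apply abs_summable_le with (fun n => Cmod (u n) + Cmod (v n)).
  - intros n; apply Cmod_triangle.
  - apply (ex_series_plus (K:=R_AbsRing) (V:=R_NormedModule)); assumption.
Qed.

Lemma abs_summable_scal (c : C) (u : nat -> C) :
  abs_summable u -> abs_summable (fun n => c * u n)%C.
Proof.
  intros Hu. apply abs_summable_le with (fun n => Cmod c * Cmod (u n)).
  - intros n; rewrite Cmod_mult; lra.
  - apply ex_series_Rmult_l; exact Hu.
Qed.

Lemma abs_summable_incr_1 (u : nat -> C) :
  abs_summable u <-> abs_summable (fun n => u (S n)).
Proof. apply (ex_series_incr_1 (K:=R_AbsRing) (V:=R_NormedModule) (fun n => Cmod (u n))). Qed.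

Lemma CSeries_plus (u v : nat -> C) :
  abs_summable u -> abs_summable v ->
  CSeries (fun n => u n + v n)%C = (CSeries u + CSeries v)%C.
Proof.
  intros Hu Hv. unfold CSeries, Cplus; simpl. f_equal.
  - rewrite <- Series_plus; [reflexivity|now apply abs_summable_Re..].
  - rewrite <- Series_plus; [reflexivity|now apply abs_summable_Im..].
Qed.

Lemma CSeries_scal (c : C) (u : nat -> C) :
  abs_summable u -> CSeries (fun n => c * u n)%C = (c * CSeries u)%C.
Proof.
  intros Hu. pose proof (abs_summable_Re _ Hu) as H1. pose proof (abs_summable_Im _ Hu) as H2.
  destruct c as [x y]. unfold CSeries, Cmult; simpl.
  f_equal; rewrite <- !Series_scal_l.
  - rewrite <- Series_minus; [reflexivity|apply ex_series_Rmult_l; assumption..].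
  - rewrite <- Series_plus; [reflexivity|apply ex_series_Rmult_l; assumption..].
Qed.

Lemma CSeries_minus (u v : nat -> C) :
  abs_summable u -> abs_summable v ->
  CSeries (fun n => u n - v n)%C = (CSeries u - CSeries v)%C.
Proof.
  intros Hu Hv.
  rewrite (CSeries_ext _ (fun n => u n + (RtoC (-1)) * v n)%C).
  - rewrite CSeries_plus, CSeries_scal; [ring|assumption|assumption|].
    now apply abs_summable_scal.
  - intros n; ring.
Qed.

Lemma CSeries_incr_1 (u : nat -> C) :
  abs_summable u -> CSeries u = (u O + CSeries (fun n => u (S n)))%C.
Proof.
  intros Hu. unfold CSeries, Cplus; simpl. f_equal.
  - now apply Series_incr_1, abs_summable_Re.
  - now apply Series_incr_1, abs_summable_Im.
Qed.

Lemma CSeries_zero : CSeries (fun _ => 0%C) = 0%C.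
Proof.
  rewrite (CSeries_ext _ (fun n => 0 * 0)%C) by (intros; ring).
  rewrite CSeries_scal; [ring|].
  apply (abs_summable_ext (fun n => RtoC (0 * (1/2)^n))).
  - intros; now rewrite Rmult_0_l.
  - apply abs_summable_le with (fun n => (1/2)^n).
    + intros n. rewrite Rmult_0_l, Cmod_0. apply pow_le; lra.
    + apply ex_series_geom. rewrite Rabs_pos_eq; lra.
Qed.

(* With S the sum of the series, |S|^2 is the real part of the sum of the conj(S) u_n. *)
Lemma Cmod_CSeries_le (u : nat -> C) :
  abs_summable u -> Cmod (CSeries u) <= Series (fun n => Cmod (u n)).
Proof.
  intros Hu. set (s := CSeries u).
  assert (H0 : 0 <= Series (fun n => Cmod (u n))).
  { apply Series_nonneg; [intros; apply Cmod_ge_0|exact Hu]. }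
  assert (H : Cmod s * Cmod s <= Cmod s * Series (fun n => Cmod (u n))).
  { assert (E : Cmod s * Cmod s = Re (CSeries (fun n => Cconj s * u n)%C)).
    { rewrite CSeries_scal by exact Hu. fold s.
      replace (Cmod s * Cmod s) with (Cmod s ^ 2) by ring.
      rewrite Cmod2_alt. unfold Cmult, Cconj, Re, Im; simpl. ring. }
    rewrite E, <- Series_scal_l. unfold CSeries; simpl.
    set (v := fun n => (Cconj s * u n)%C).
    assert (Hv : ex_series (fun n => Rabs (Re (v n)))).
    { eapply ex_series_le_nonneg; [|exact (abs_summable_scal (Cconj s) u Hu)].
      intros n; split; [apply Rabs_pos|apply re_le_Cmod]. }
    eapply Rle_trans; [apply Rle_abs|].
    eapply Rle_trans; [apply (Series_Rabs (fun n => Re (v n)) Hv)|].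
    apply Series_le.
    - intros n; split; [apply Rabs_pos|].
      eapply Rle_trans; [apply re_le_Cmod|].
      unfold v. rewrite Cmod_mult, Cmod_conj; lra.
    - apply ex_series_Rmult_l; exact Hu. }
  destruct (Req_dec (Cmod s) 0) as [E|E]; [lra|].
  pose proof (Cmod_ge_0 s). apply Rmult_le_reg_l with (Cmod s); lra.
Qed.

Lemma Re_sum_n (u : nat -> C) (n : nat) :
  Re (sum_n (G:=C_NormedModule) u n) = sum_n (fun k => Re (u k)) n.
Proof.
  induction n as [|n IH]; [now rewrite !sum_O|].
  rewrite !sum_Sn. rewrite <- IH. reflexivity.
Qed.

Lemma Im_sum_n (u : nat -> C) (n : nat) :
  Im (sum_n (G:=C_NormedModule) u n) = sum_n (fun k => Im (u k)) n.
Proof.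
  induction n as [|n IH]; [now rewrite !sum_O|].
  rewrite !sum_Sn. rewrite <- IH. reflexivity.
Qed.

(** Balls of [C_NormedModule] are products of balls of the coordinates, so a neighbourhood of [Re l]
    or [Im l] lifts to one of [l]. *)
Lemma is_series_C_components (u : nat -> C) (l : C) :
  @is_series C_AbsRing C_NormedModule u l ->
  is_series (fun n => Re (u n)) (Re l) /\ is_series (fun n => Im (u n)) (Im l).
Proof.
  intros H. split.
  - intros P [eps HP]. unfold filtermap.
    assert (Q : locally (T:=C_NormedModule) l (fun y => P (Re y))).
    { exists eps. intros y [Hy _]. now apply HP. }
    apply H in Q. destruct Q as [N HN]. exists N. intros n Hn.
    rewrite <- Re_sum_n. now apply HN.
  - intros P [eps HP]. unfold filtermap.
    assert (Q : locally (T:=C_NormedModule) l (fun y => P (Im y))).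
    { exists eps. intros y [_ Hy]. now apply HP. }
    apply H in Q. destruct Q as [N HN]. exists N. intros n Hn.
    rewrite <- Im_sum_n. now apply HN.
Qed.

Lemma is_series_CSeries (u : nat -> C) (l : C) :
  @is_series C_AbsRing C_NormedModule u l -> CSeries u = l.
Proof.
  intros H. apply is_series_C_components in H. destruct H as [H1 H2].
  unfold CSeries. rewrite (is_series_unique _ _ H1), (is_series_unique _ _ H2).
  now destruct l.
Qed.

Lemma ex_series_bounded (a : nat -> R) :
  ex_series a -> exists M, forall n, Rabs (a n) <= M.
Proof.
  intros H. apply ex_series_lim_0 in H. apply is_lim_seq_Reals in H.
  assert (B : exists M, forall n, Rabs (a n) <= M).
  { destruct (maj_by_pos a (exist _ 0 H)) as [M [_ HM]]. now exists M. }
  exact B.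
Qed.

(** * Complex power series on a disc *)

Definition PS (a : nat -> C) (z : C) : C := CSeries (fun n => a n * z ^ n)%C.

(** Formulated with moduli at real radii, so that comparison of real series and the real [CV_radius]
    apply. *)
Definition abs_conv_disc (a : nat -> C) (rad : R) : Prop :=
  forall r, 0 <= r < rad -> ex_series (fun n => Cmod (a n) * r ^ n).

Lemma abs_conv_disc_summable (a : nat -> C) (rad : R) (z : C) :
  abs_conv_disc a rad -> Cmod z < rad -> abs_summable (fun n => a n * z ^ n)%C.
Proof.
  intros Ha Hz. apply (abs_summable_le _ (fun n => Cmod (a n) * Cmod z ^ n)).
  - intros n; rewrite Cmod_mult, Cmod_pow; lra.
  - apply Ha; split; [apply Cmod_ge_0|exact Hz].
Qed.

(** Abel's lemma: convergence at a point [rho] between [r] and [rad] bounds the terms a_n rho^n, and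
    the series at [r] is then dominated by a geometric series of ratio r / rho. *)
Lemma abs_conv_disc_of_converges (a : nat -> C) (f : C -> C) (rad : R) :
  (forall z, Cmod z < rad -> @is_pseries C_AbsRing C_NormedModule a z (f z)) ->
  abs_conv_disc a rad /\ forall z, Cmod z < rad -> f z = PS a z.
Proof.
  intros H.
  assert (H' : forall z, Cmod z < rad ->
     @is_series C_AbsRing C_NormedModule (fun n => a n * z ^ n)%C (f z)).
  { intros z Hz. generalize (H z Hz). unfold is_pseries. apply is_series_ext.
    intros n. change (pow_n z n * a n = a n * z ^ n)%C.
    apply Cmult_comm. }
  split.
  - intros r Hr. set (rho := (r + rad) / 2).
    assert (Hrho : r < rho < rad) by (unfold rho; lra).
    assert (E : Cmod (RtoC rho) = rho) by (rewrite Cmod_R, Rabs_pos_eq; lra).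
    destruct (is_series_C_components _ _ (H' (RtoC rho) ltac:(lra))) as [H1 H2].
    destruct (ex_series_bounded _ (ex_intro _ _ H1)) as [M1 HM1].
    destruct (ex_series_bounded _ (ex_intro _ _ H2)) as [M2 HM2].
    apply ex_series_le_nonneg with (fun n => (M1 + M2) * (r / rho) ^ n).
    + intros n; split.
      * apply Rmult_le_pos; [apply Cmod_ge_0|apply pow_le; lra].
      * assert (B : Cmod (a n) * rho ^ n <= M1 + M2).
        { replace (Cmod (a n) * rho ^ n) with (Cmod (a n * RtoC rho ^ n)%C)
            by (rewrite Cmod_mult, Cmod_pow, E; reflexivity).
          specialize (HM1 n); specialize (HM2 n).
          set (c := (a n * RtoC rho ^ n)%C) in *.
          replace c with (RtoC (Re c) + Ci * RtoC (Im c))%C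
            by (destruct c as [x y]; unfold Cplus, Cmult, Ci, RtoC, Re, Im; simpl; f_equal; ring).
          eapply Rle_trans; [apply Cmod_triangle|].
          rewrite Cmod_mult, Cmod_Ci, !Cmod_R. lra. }
        replace (r ^ n) with (rho ^ n * (r / rho) ^ n).
        2:{ rewrite <- Rpow_mult_distr. f_equal. field. lra. }
        rewrite <- Rmult_assoc. apply Rmult_le_compat_r; [|exact B].
        apply pow_le. apply Rmult_le_pos; [lra|]. left; apply Rinv_0_lt_compat; lra.
    + apply ex_series_Rmult_l. apply ex_series_geom.
      rewrite Rabs_pos_eq.
      * apply Rmult_lt_reg_r with rho; [lra|]. unfold Rdiv. rewrite Rmult_assoc, Rinv_l; lra.
      * apply Rmult_le_pos; [lra|]. left; apply Rinv_0_lt_compat; lra.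
  - intros z Hz. symmetry. apply is_series_CSeries. now apply H'.
Qed.

(** * Termwise differentiation and Taylor coefficients *)

Definition shift_derive (a : nat -> C) (n : nat) : C := (INR (S n) * a (S n))%C.

(** Taking moduli commutes with deriving coefficients, so this reduces to the invariance of the real
    radius of convergence under [PS_derive]. *)
Lemma abs_conv_disc_derive (a : nat -> C) (rad : R) :
  abs_conv_disc a rad -> abs_conv_disc (shift_derive a) rad.
Proof.
  intros Ha r Hr. set (rho := (r + rad) / 2).
  assert (Hrho : r < rho < rad) by (unfold rho; lra).
  set (b := fun n => Cmod (a n)).
  (* Convergence at [rho] puts [rho] in the set whose supremum is [CV_radius b]. *)
  assert (Hb : Rbar_le rho (CV_radius b)).
  { unfold CV_radius, Lub.Lub_Rbar. destruct (Lub.ex_lub_Rbar (CV_disk b)) as [l Hl]; simpl.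
    apply (proj1 Hl). unfold CV_disk.
    apply ex_series_ext with (fun n => b n * rho ^ n).
    - intros n. rewrite Rabs_pos_eq; [reflexivity|].
      apply Rmult_le_pos; [apply Cmod_ge_0|apply pow_le; lra].
    - apply Ha; lra. }
  assert (Hd : Rbar_lt (Rabs r) (CV_radius (PS_derive b))).
  { rewrite CV_radius_derive. eapply Rbar_lt_le_trans; [|exact Hb].
    simpl. rewrite Rabs_pos_eq; lra. }
  apply CV_disk_inside in Hd. revert Hd. apply ex_series_ext. intros n.
  unfold PS_derive, shift_derive, b.
  rewrite Rabs_pos_eq.
  - rewrite Cmod_mult, Cmod_R, Rabs_pos_eq by apply pos_INR. reflexivity.
  - apply Rmult_le_pos; [apply Rmult_le_pos; [apply pos_INR|apply Cmod_ge_0]|apply pow_le; lra].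
Qed.

(** The error for the next exponent is y times the current one plus (k + 2) z^(k+1) (y - z)^2. The
    factor 1/2 of Taylor's formula is given up: (k + 1)(k + 2) is exactly what two applications of
    [shift_derive] produce. *)
Lemma Cpow_taylor2 (y z : C) (rho : R) (k : nat) :
  Cmod y <= rho -> Cmod z <= rho ->
  Cmod (y ^ (k + 2) - z ^ (k + 2) - INR (k + 2) * z ^ (k + 1) * (y - z))%C
  <= INR (k + 1) * INR (k + 2) * rho ^ k * Cmod (y - z) ^ 2.
Proof.
  intros Hy Hz. pose proof (Cmod_ge_0 y) as Py. pose proof (Cmod_ge_0 z) as Pz.
  pose proof (Cmod_ge_0 (y - z)%C) as Ph.
  induction k as [|k IH].
  - replace (y ^ (0 + 2) - z ^ (0 + 2) - INR (0 + 2) * z ^ (0 + 1) * (y - z))%C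
      with ((y - z) * (y - z))%C by (simpl; rewrite RtoC_plus; ring).
    rewrite Cmod_mult. simpl. nra.
  - replace (y ^ (S k + 2) - z ^ (S k + 2) - INR (S k + 2) * z ^ (S k + 1) * (y - z))%C
      with (y * (y ^ (k + 2) - z ^ (k + 2) - INR (k + 2) * z ^ (k + 1) * (y - z))
            + INR (k + 2) * z ^ (k + 1) * ((y - z) * (y - z)))%C.
    2:{ replace (S k + 2)%nat with (S (k + 2)) by lia. rewrite S_INR, RtoC_plus.
        replace (S k + 1)%nat with (S (k + 1)) by lia.
        replace (k + 2)%nat with (S (k + 1)) by lia. rewrite !Cpow_S. ring. }
    eapply Rle_trans; [apply Cmod_triangle|]. rewrite !Cmod_mult, Cmod_pow, Cmod_R.
    rewrite Rabs_pos_eq by apply pos_INR.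
    assert (H1 : Cmod z ^ (k + 1) <= rho ^ (k + 1)) by (apply pow_incr; lra).
    set (E := Cmod (y ^ (k + 2) - z ^ (k + 2) - INR (k + 2) * z ^ (k + 1) * (y - z))%C) in *.
    assert (H2 : Cmod y * E <= rho * (INR (k + 1) * INR (k + 2) * rho ^ k * Cmod (y - z) ^ 2)).
    { apply Rmult_le_compat; auto. apply Cmod_ge_0. }
    assert (H3 : INR (k + 2) * Cmod z ^ (k + 1) * (Cmod (y - z) * Cmod (y - z))
        <= INR (k + 2) * rho ^ (k + 1) * (Cmod (y - z) * Cmod (y - z))).
    { apply Rmult_le_compat_r; [nra|]. apply Rmult_le_compat_l; [apply pos_INR|exact H1]. }
    assert (H4 : 0 <= rho ^ (k + 1)) by (apply pow_le; lra).
    assert (H5 : 0 <= INR (k + 2) * rho ^ (k + 1) * Cmod (y - z) ^ 2).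
    { apply Rmult_le_pos; [apply Rmult_le_pos; [apply pos_INR|exact H4]|apply pow_le, Ph]. }
    replace (S k + 2)%nat with (S (k + 2)) by lia.
    replace (S k + 1)%nat with (k + 2)%nat by lia. rewrite S_INR.
    assert (H6 : rho ^ (k + 1) = rho * rho ^ k) by (rewrite Nat.add_1_r; reflexivity).
    assert (H7 : INR (k + 2) = INR (k + 1) + 1) by (rewrite <- S_INR; f_equal; lia).
    rewrite H6 in *. simpl (rho ^ S k). set (q := rho ^ k) in *. set (m := INR (k + 1)) in *.
    rewrite H7 in *. set (h := Cmod (y - z)) in *. nra.
Qed.

Lemma is_derive_C_intro (f : C -> C) (z l : C) (M delta : R) :
  0 < delta ->
  (forall y, Cmod (y - z) < delta ->
     Cmod (f y - f z - (y - z) * l) <= M * Cmod (y - z) ^ 2)%C ->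
  @is_derive C_AbsRing C_NormedModule f z l.
Proof.
  intros Hd H. split.
  - apply is_linear_scal_l.
  - intros x Hx. apply (is_filter_lim_locally_unique (K:=C_AbsRing) (V:=AbsRing_NormedModule C_AbsRing)) in Hx. subst x.
    intros eps.
    (* Adding 1 to |M| keeps the quotient meaningful when [M] is 0. *)
    assert (He : 0 < Rmin delta (eps / (Rabs M + 1))).
    { apply Rmin_pos; [exact Hd|]. apply Rdiv_lt_0_compat; [apply cond_pos|].
      pose proof (Rabs_pos M); lra. }
    exists (mkposreal _ He). intros y Hy.
    change (Cmod (y - z) < Rmin delta (eps / (Rabs M + 1))) in Hy.
    change (Cmod (f y - f z - (y - z) * l)%C <= eps * Cmod (y - z)%C).
    pose proof (Rmin_l delta (eps / (Rabs M + 1))).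
    pose proof (Rmin_r delta (eps / (Rabs M + 1))).
    eapply Rle_trans; [apply H; lra|].
    pose proof (Cmod_ge_0 (y - z)%C) as Ph. set (h := Cmod (y - z)%C) in *.
    assert (h * (Rabs M + 1) <= eps).
    { pose proof (Rabs_pos M).
      replace (pos eps) with (eps / (Rabs M + 1) * (Rabs M + 1)) by (field; lra).
      apply Rmult_le_compat_r; lra. }
    pose proof (Rle_abs M). nra.
Qed.

(** The linearisation error of the sum is the series of the errors of the single powers. Orders 0
    and 1 have none, and [Cpow_taylor2] bounds the others by |y - z|^2 times the terms of the twice
    derived series at [rho], whose sum is [M]. *)
Lemma is_derive_PS (a : nat -> C) (rad : R) (z : C) :
  abs_conv_disc a rad -> Cmod z < rad ->
  @is_derive C_AbsRing C_NormedModule (PS a) z (PS (shift_derive a) z).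
Proof.
  intros Ha Hz. set (rho := (Cmod z + rad) / 2).
  pose proof (Cmod_ge_0 z) as Pz.
  assert (Hrho : Cmod z < rho < rad) by (unfold rho; lra).
  pose proof (abs_conv_disc_derive _ _ Ha) as Ha1.
  pose proof (abs_conv_disc_derive _ _ Ha1) as Ha2.
  set (M := Series (fun k => Cmod (shift_derive (shift_derive a) k) * rho ^ k)).
  apply (is_derive_C_intro _ _ _ M (rho - Cmod z)); [lra|].
  intros y Hy.
  assert (Hyr : Cmod y < rho).
  { replace y with (z + (y - z))%C by ring.
    eapply Rle_lt_trans; [apply Cmod_triangle|]. lra. }
  pose proof (abs_conv_disc_summable a rad y Ha ltac:(lra)) as Sy.
  pose proof (abs_conv_disc_summable a rad z Ha Hz) as Sz.
  pose proof (abs_conv_disc_summable _ rad z Ha1 Hz) as Sd.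
  pose proof (proj1 (abs_summable_incr_1 _) Sy) as Sy1.
  pose proof (proj1 (abs_summable_incr_1 _) Sy1) as Sy2.
  pose proof (proj1 (abs_summable_incr_1 _) Sz) as Sz1.
  pose proof (proj1 (abs_summable_incr_1 _) Sz1) as Sz2.
  pose proof (proj1 (abs_summable_incr_1 _) Sd) as Sd1.
  set (e := fun k => (a (S (S k)) *
      (y ^ (k + 2) - z ^ (k + 2) - INR (k + 2) * z ^ (k + 1) * (y - z)))%C).
  assert (E : (PS a y - PS a z - (y - z) * PS (shift_derive a) z)%C = CSeries e).
  { unfold PS. rewrite (CSeries_incr_1 _ Sy), (CSeries_incr_1 _ Sy1).
    rewrite (CSeries_incr_1 _ Sz), (CSeries_incr_1 _ Sz1), (CSeries_incr_1 _ Sd).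
    rewrite (CSeries_ext e (fun k => (a (S (S k)) * y ^ S (S k) - a (S (S k)) * z ^ S (S k))
       - (y - z) * (shift_derive a (S k) * z ^ S k))%C).
    - rewrite CSeries_minus, CSeries_minus, CSeries_scal; [|exact Sd1|exact Sy2|exact Sz2| |].
      + unfold shift_derive. simpl. ring.
      + apply (abs_summable_ext (fun n => a (S (S n)) * y ^ S (S n) + (RtoC (-1)) * (a (S (S n)) * z ^ S (S n)))%C).
        * intros; ring.
        * apply abs_summable_plus; [exact Sy2|apply abs_summable_scal; exact Sz2].
      + apply abs_summable_scal; exact Sd1.
    - intros k. unfold e, shift_derive.
      replace (k + 2)%nat with (S (S k)) by lia. replace (k + 1)%nat with (S k) by lia. ring. }
  rewrite E.
  assert (B : forall k, Cmod (e k) <= Cmod (y - z) ^ 2 *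
            (Cmod (shift_derive (shift_derive a) k) * rho ^ k)).
  { intros k. unfold e, shift_derive. rewrite !Cmod_mult, !Cmod_R, !Rabs_pos_eq by apply pos_INR.
    pose proof (Cpow_taylor2 y z rho k ltac:(lra) ltac:(lra)) as T.
    pose proof (Cmod_ge_0 (a (S (S k)))).
    replace (k + 2)%nat with (S (S k)) in * by lia. replace (k + 1)%nat with (S k) in * by lia.
    eapply Rle_trans; [apply Rmult_le_compat_l; [assumption|exact T]|]. right; ring. }
  assert (X : ex_series (fun k => Cmod (y - z) ^ 2 *
            (Cmod (shift_derive (shift_derive a) k) * rho ^ k))).
  { apply ex_series_Rmult_l. apply Ha2. lra. }
  eapply Rle_trans; [apply Cmod_CSeries_le; now apply abs_summable_le with (1 := B)|].
  eapply Rle_trans; [apply Series_le; [|exact X]|].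
  - intros n; split; [apply Cmod_ge_0|apply B].
  - rewrite Series_scal_l. fold M. right; ring.
Qed.

Lemma is_derive_eq_PS (a : nat -> C) (rad : R) (f : C -> C) (z : C) :
  abs_conv_disc a rad -> (forall y, Cmod y < rad -> f y = PS a y) -> Cmod z < rad ->
  @is_derive C_AbsRing C_NormedModule f z (PS (shift_derive a) z).
Proof.
  intros Ha Hf Hz. eapply is_derive_ext_loc; [|now apply is_derive_PS with rad].
  assert (He : 0 < rad - Cmod z) by lra.
  exists (mkposreal _ He). intros y Hy. symmetry; apply Hf.
  change (Cmod (y - z) < rad - Cmod z) in Hy.
  replace y with (z + (y - z))%C by ring.
  eapply Rle_lt_trans; [apply Cmod_triangle|]. lra.
Qed.

Lemma C_derive_n_eq_PS (a : nat -> C) (rad : R) (f : C -> C) (n : nat) :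
  abs_conv_disc a rad -> (forall y, Cmod y < rad -> f y = PS a y) ->
  abs_conv_disc (Nat.iter n shift_derive a) rad /\
  forall z, Cmod z < rad -> C_derive_n f n z = PS (Nat.iter n shift_derive a) z.
Proof.
  intros Ha Hf. induction n as [|n [IH1 IH2]]; [now split|]. split.
  - now apply abs_conv_disc_derive.
  - intros z Hz. apply is_C_derive_unique. now apply is_derive_eq_PS with rad.
Qed.

Lemma PS_0 (a : nat -> C) (rad : R) : 0 < rad -> abs_conv_disc a rad -> PS a 0%C = a O.
Proof.
  intros HR Ha. unfold PS. rewrite CSeries_incr_1.
  - rewrite (CSeries_ext _ (fun _ => 0%C)) by (intros; simpl; ring).
    rewrite CSeries_zero. simpl. ring.
  - apply abs_conv_disc_summable with rad; [exact Ha|rewrite Cmod_0; exact HR].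
Qed.

(** A general [k] is needed because the induction moves one index from [n] to [k]; the factorial on
    the left avoids a division. Only k = 0 is used afterwards. *)
Lemma iter_shift_derive_0 (n : nat) (a : nat -> C) (k : nat) :
  (Nat.iter n shift_derive a k * INR (fact k) = INR (fact (n + k)) * a (n + k)%nat)%C.
Proof.
  revert k. induction n as [|n IH]; intros k; [simpl; ring|].
  change (Nat.iter (S n) shift_derive a k)
    with (INR (S k) * Nat.iter n shift_derive a (S k))%C.
  replace (S n + k)%nat with (n + S k)%nat by lia. rewrite <- IH.
  rewrite fact_simpl, mult_INR, RtoC_mult. ring.
Qed.

(** Links the coefficients in [J_op], defined by iterated derivatives, to the expansion that
    [class_R] provides. *)
Lemma taylor_coef_eq_PS (a : nat -> C) (rad : R) (f : C -> C) (n : nat) :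
  0 < rad -> abs_conv_disc a rad -> (forall y, Cmod y < rad -> f y = PS a y) ->
  taylor_coef f n = a n.
Proof.
  intros HR Ha Hf. destruct (C_derive_n_eq_PS a rad f n Ha Hf) as [H1 H2].
  unfold taylor_coef. rewrite H2 by now rewrite Cmod_0.
  rewrite (PS_0 _ rad HR H1).
  pose proof (iter_shift_derive_0 n a 0) as E. rewrite Nat.add_0_r in E. simpl fact in E.
  simpl INR in E at 1. rewrite Cmult_1_r in E. rewrite E. field.
  intros F. apply RtoC_inj in F. exact (INR_fact_neq_0 n F).
Qed.

Lemma PS_ext (u v : nat -> C) (z : C) : (forall n, u n = v n) -> PS u z = PS v z.
Proof. intros H. apply CSeries_ext. intros n. now rewrite H. Qed.

Lemma abs_conv_disc_plus (u v : nat -> C) (rad : R) :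
  abs_conv_disc u rad -> abs_conv_disc v rad -> abs_conv_disc (fun n => u n + v n)%C rad.
Proof.
  intros Hu Hv r Hr.
  apply ex_series_le_nonneg with (fun n => Cmod (u n) * r ^ n + Cmod (v n) * r ^ n).
  - intros n. assert (0 <= r ^ n) by (apply pow_le; lra). split.
    + apply Rmult_le_pos; [apply Cmod_ge_0|assumption].
    + rewrite <- Rmult_plus_distr_r. apply Rmult_le_compat_r; [assumption|apply Cmod_triangle].
  - apply (ex_series_plus (K:=R_AbsRing) (V:=R_NormedModule)); [now apply Hu|now apply Hv].
Qed.

Lemma abs_conv_disc_scal (c : C) (u : nat -> C) (rad : R) :
  abs_conv_disc u rad -> abs_conv_disc (fun n => c * u n)%C rad.
Proof.
  intros Hu r Hr. apply ex_series_ext with (fun n => Cmod c * (Cmod (u n) * r ^ n)).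
  - intros n. rewrite Cmod_mult. symmetry; apply Rmult_assoc.
  - apply ex_series_Rmult_l. now apply Hu.
Qed.

Lemma PS_plus (u v : nat -> C) (rad : R) (z : C) :
  abs_conv_disc u rad -> abs_conv_disc v rad -> Cmod z < rad ->
  PS (fun n => u n + v n)%C z = (PS u z + PS v z)%C.
Proof.
  intros Hu Hv Hz. unfold PS.
  rewrite (CSeries_ext _ (fun n => u n * z ^ n + v n * z ^ n)%C) by (intros; ring).
  apply CSeries_plus; eapply abs_conv_disc_summable; eassumption.
Qed.

Lemma PS_scal (c : C) (u : nat -> C) (rad : R) (z : C) :
  abs_conv_disc u rad -> Cmod z < rad -> PS (fun n => c * u n)%C z = (c * PS u z)%C.
Proof.
  intros Hu Hz. unfold PS.
  rewrite (CSeries_ext _ (fun n => c * (u n * z ^ n))%C) by (intros; ring).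
  apply CSeries_scal; eapply abs_conv_disc_summable; eassumption.
Qed.

Definition mul_z (u : nat -> C) (n : nat) : C := match n with O => 0%C | S k => u k end.

Lemma abs_conv_disc_mul_z (u : nat -> C) (rad : R) : abs_conv_disc u rad -> abs_conv_disc (mul_z u) rad.
Proof.
  intros Hu r Hr.
  apply (ex_series_incr_1 (K:=R_AbsRing) (V:=R_NormedModule)).
  apply ex_series_ext with (fun n => r * (Cmod (u n) * r ^ n)).
  - intros n. simpl. ring.
  - apply ex_series_Rmult_l. now apply Hu.
Qed.

Lemma PS_mul_z (u : nat -> C) (rad : R) (z : C) :
  abs_conv_disc u rad -> Cmod z < rad -> (z * PS u z)%C = PS (mul_z u) z.
Proof.
  intros Hu Hz. pose proof (abs_conv_disc_summable _ _ _ (abs_conv_disc_mul_z _ _ Hu) Hz) as S1.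
  unfold PS. rewrite (CSeries_incr_1 _ S1). simpl.
  rewrite <- (CSeries_scal z) by (eapply abs_conv_disc_summable; eassumption).
  rewrite Cmult_0_l, Cplus_0_l. apply CSeries_ext. intros n. ring.
Qed.

(** The factor rho^k, and not merely 1, is kept: it supplies the strict contraction in
    [coef_univalent]. *)
Lemma Cpow_lipschitz (y z : C) (rho : R) (k : nat) :
  Cmod y <= rho -> Cmod z <= rho ->
  Cmod (y ^ S k - z ^ S k)%C <= INR (S k) * rho ^ k * Cmod (y - z).
Proof.
  intros Hy Hz. pose proof (Cmod_ge_0 y) as Py. pose proof (Cmod_ge_0 z) as Pz.
  pose proof (Cmod_ge_0 (y - z)%C) as Ph.
  induction k as [|k IH].
  - simpl. rewrite !Cmult_1_r. lra.
  - replace (y ^ S (S k) - z ^ S (S k))%C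
      with (y * (y ^ S k - z ^ S k) + z ^ S k * (y - z))%C by (rewrite !Cpow_S; ring).
    eapply Rle_trans; [apply Cmod_triangle|]. rewrite !Cmod_mult, Cmod_pow.
    assert (H1 : Cmod z ^ S k <= rho ^ S k) by (apply pow_incr; lra).
    assert (H2 : Cmod y * Cmod (y ^ S k - z ^ S k)%C <= rho * (INR (S k) * rho ^ k * Cmod (y - z)))
      by (apply Rmult_le_compat; auto using Cmod_ge_0).
    assert (H3 : Cmod z ^ S k * Cmod (y - z) <= rho ^ S k * Cmod (y - z))
      by (apply Rmult_le_compat_r; assumption).
    rewrite (S_INR (S k)). simpl (rho ^ S k) in *. nra.
Qed.

(** * Means over roots of unity *)

Definition cis (t : R) : C := (cos t, sin t).

Lemma Cmod_cis (t : R) : Cmod (cis t) = 1.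
Proof.
  unfold Cmod, cis; simpl. rewrite !Rmult_1_r. pose proof (sin2_cos2 t) as H. unfold Rsqr in H.
  rewrite Rplus_comm, H. apply sqrt_1.
Qed.

Lemma cis_plus (s t : R) : cis (s + t) = (cis s * cis t)%C.
Proof.
  unfold cis, Cmult; simpl. rewrite cos_plus, sin_plus. f_equal; ring.
Qed.

Lemma cis_0 : cis 0 = 1%C.
Proof. unfold cis. now rewrite cos_0, sin_0. Qed.

Lemma cis_pow (t : R) (n : nat) : (cis t ^ n)%C = cis (INR n * t).
Proof.
  induction n as [|n IH]; [simpl; now rewrite Rmult_0_l, cis_0|].
  rewrite Cpow_S, IH, <- cis_plus, S_INR. f_equal; ring.
Qed.

Lemma cis_2PI_mult (k : nat) : cis (2 * PI * INR k) = 1%C.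
Proof.
  replace (2 * PI * INR k) with (INR k * (2 * PI)) by ring. rewrite <- cis_pow.
  unfold cis. rewrite cos_2PI, sin_2PI. apply Cpow_1_l.
Qed.

Lemma cis_neq_1 (t : R) : 0 < t < 2 * PI -> cis t <> 1%C.
Proof.
  intros Ht E. apply (f_equal fst) in E. unfold cis in E; simpl in E.
  replace t with (2 * (t / 2)) in E by field. rewrite cos_2a_sin in E.
  pose proof (sin_gt_0 (t / 2) ltac:(lra) ltac:(lra)). nra.
Qed.

Definition root_pt (r : R) (N j : nat) : C := (r * cis (2 * PI * INR j / INR N))%C.

Lemma Cmod_root_pt (r : R) (N j : nat) : 0 <= r -> Cmod (root_pt r N j) = r.
Proof.
  intros H. unfold root_pt. rewrite Cmod_mult, Cmod_cis, Cmod_R, Rabs_pos_eq; lra.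
Qed.

Definition Csum (u : nat -> C) (n : nat) : C := sum_n (G:=C_NormedModule) u n.

Lemma Csum_0 (u : nat -> C) : Csum u 0 = u O.
Proof. apply (sum_O (G:=C_NormedModule)). Qed.

Lemma Csum_S (u : nat -> C) (n : nat) : Csum u (S n) = (Csum u n + u (S n))%C.
Proof. apply (sum_Sn (G:=C_NormedModule)). Qed.

Lemma Csum_plus (u v : nat -> C) (n : nat) :
  Csum (fun k => u k + v k)%C n = (Csum u n + Csum v n)%C.
Proof. induction n; rewrite ?Csum_0, ?Csum_S; [reflexivity|]. rewrite IHn; ring. Qed.

Lemma Csum_scal (c : C) (u : nat -> C) (n : nat) :
  Csum (fun k => c * u k)%C n = (c * Csum u n)%C.
Proof. induction n; rewrite ?Csum_0, ?Csum_S; [reflexivity|]. rewrite IHn; ring. Qed.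

Lemma Csum_ext (u v : nat -> C) (n : nat) :
  (forall k, u k = v k) -> Csum u n = Csum v n.
Proof. intros H; induction n; rewrite ?Csum_0, ?Csum_S; rewrite ?IHn, H; reflexivity. Qed.

Lemma Csum_Re_le (u : nat -> C) (b : R) (n : nat) :
  (forall k, Re (u k) <= b) -> Re (Csum u n) <= INR (S n) * b.
Proof.
  intros H; induction n; rewrite ?Csum_0, ?Csum_S.
  - simpl; specialize (H O); lra.
  - rewrite S_INR. change (Re (Csum u n + u (S n))%C) with (Re (Csum u n) + Re (u (S n))).
    specialize (H (S n)); lra.
Qed.

Lemma Csum_geom (q : C) (n : nat) :
  ((1 - q) * Csum (fun k => q ^ k)%C n = 1 - q ^ S n)%C.
Proof.
  induction n; rewrite ?Csum_0, ?Csum_S; [simpl; ring|].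
  rewrite Cmult_plus_distr_l, IHn, !Cpow_S. ring.
Qed.

(* The mean is over N + 1 points, so that the count is never zero. *)
Definition circle_mean (r : R) (N : nat) (F : C -> C) : C :=
  (/ INR (S N) * Csum (fun j => F (root_pt r (S N) j)) N)%C.

Lemma circle_mean_plus (r : R) (N : nat) (F G : C -> C) :
  circle_mean r N (fun z => F z + G z)%C = (circle_mean r N F + circle_mean r N G)%C.
Proof. unfold circle_mean. rewrite Csum_plus. ring. Qed.

Lemma circle_mean_scal (r : R) (N : nat) (c : C) (F : C -> C) :
  circle_mean r N (fun z => c * F z)%C = (c * circle_mean r N F)%C.
Proof. unfold circle_mean. rewrite Csum_scal. ring. Qed.

Lemma INR_S_C_neq_0 (N : nat) : RtoC (INR (S N)) <> 0%C.
Proof. intros E. apply RtoC_inj in E. apply (not_0_INR (S N)); [lia|exact E]. Qed.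

Lemma circle_mean_ext (r : R) (N : nat) (F G : C -> C) :
  (forall j, F (root_pt r (S N) j) = G (root_pt r (S N) j)) -> circle_mean r N F = circle_mean r N G.
Proof. intros H. unfold circle_mean. f_equal. now apply Csum_ext. Qed.

Lemma circle_mean_Re_le (r : R) (N : nat) (F : C -> C) (b : R) :
  0 <= r -> (forall z, Cmod z = r -> Re (F z) <= b) -> Re (circle_mean r N F) <= b.
Proof.
  intros Hr H. unfold circle_mean.
  pose proof (Csum_Re_le (fun j => F (root_pt r (S N) j)) b N
    (fun j => H _ (Cmod_root_pt r (S N) j Hr))) as B.
  rewrite <- RtoC_inv by (apply not_0_INR; lia).
  set (s := Csum _ _) in *.
  replace (Re (RtoC (/ INR (S N)) * s)%C) with (/ INR (S N) * Re s)
    by (unfold Cmult, RtoC, Re; simpl; ring).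
  assert (0 < INR (S N)) by (apply lt_0_INR; lia).
  apply Rmult_le_reg_l with (INR (S N)); [assumption|]. rewrite <- Rmult_assoc, Rinv_r; lra.
Qed.

Lemma circle_mean_const (r : R) (N : nat) (c : C) : circle_mean r N (fun _ => c) = c.
Proof.
  unfold circle_mean.
  assert (E : forall n, Csum (fun _ => c) n = (INR (S n) * c)%C).
  { induction n; rewrite ?Csum_0, ?Csum_S; [simpl; ring|].
    rewrite IHn, (S_INR (S n)), RtoC_plus. ring. }
  rewrite E. field. apply INR_S_C_neq_0.
Qed.

(** For 0 < k <= N the ratio [q] of successive sample values of z^k is an (N+1)-th root of unity
    different from 1, so the geometric sum vanishes. *)
Lemma circle_mean_pow (r : R) (N k : nat) :
  (0 < k <= N)%nat -> circle_mean r N (fun z => z ^ k)%C = 0%C.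
Proof.
  intros Hk. unfold circle_mean.
  assert (HN : INR (S N) <> 0) by (apply not_0_INR; lia).
  set (q := cis (2 * PI * INR k / INR (S N))).
  rewrite (Csum_ext _ (fun j => RtoC (r ^ k) * q ^ j)%C).
  - rewrite (Csum_scal (RtoC (r ^ k)) (fun j => q ^ j)%C).
    assert (Hq : q <> 1%C).
    { apply cis_neq_1. pose proof PI_RGT_0.
      assert (0 < INR k) by (apply lt_0_INR; lia).
      assert (INR k < INR (S N)) by (apply lt_INR; lia).
      unfold Rdiv. assert (0 < / INR (S N)) by (apply Rinv_0_lt_compat; lra).
      split; [apply Rmult_lt_0_compat; nra|].
      apply Rmult_lt_reg_r with (INR (S N)); [lra|].
      rewrite Rmult_assoc, Rinv_l, Rmult_1_r by lra. nra. }
    assert (E : Csum (fun j => q ^ j)%C N = 0%C).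
    { assert (G : ((1 - q) * Csum (fun j => q ^ j)%C N = 0)%C).
      { rewrite Csum_geom. unfold q. rewrite cis_pow.
        replace (INR (S N) * (2 * PI * INR k / INR (S N))) with (2 * PI * INR k)
          by (field; exact HN).
        rewrite cis_2PI_mult. ring. }
      assert (N1 : (1 - q)%C <> 0%C).
      { intros F. apply Hq. replace q with (1 - (1 - q))%C by ring. rewrite F. ring. }
      replace (Csum (fun j => q ^ j)%C N)
        with (/ (1 - q) * ((1 - q) * Csum (fun j => q ^ j)%C N))%C by (field; exact N1).
      rewrite G. ring. }
    rewrite E. ring.
  - intros j. unfold root_pt, q. rewrite Cpow_mult_l, <- RtoC_pow. f_equal.
    rewrite !cis_pow. f_equal. field. exact HN.
Qed.

Lemma root_pt_pow (r : R) (N j : nat) : (root_pt r (S N) j ^ S N)%C = RtoC (r ^ S N).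
Proof.
  unfold root_pt. rewrite Cpow_mult_l, cis_pow, RtoC_pow.
  replace (INR (S N) * (2 * PI * INR j / INR (S N))) with (2 * PI * INR j)
    by (field; apply not_0_INR; lia).
  rewrite cis_2PI_mult. ring.
Qed.

(** * Means of polynomials *)

Definition Cpoly (w : nat -> C) (K : nat) (z : C) : C := Csum (fun k => w k * z ^ k)%C K.

(** All exponents lie between 1 and N, so no monomial looks like a constant on the N + 1 sample
    points. *)
Lemma circle_mean_Cpoly_pow (w : nat -> C) (K m : nat) (r : R) (N : nat) :
  (0 < m)%nat -> (m + K <= N)%nat ->
  circle_mean r N (fun z => Cpoly w K z * z ^ m)%C = 0%C.
Proof.
  intros Hm. induction K as [|K IH]; intros HK.
  - rewrite (circle_mean_ext _ _ _ (fun z => w O * z ^ m)%C).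
    + rewrite circle_mean_scal, circle_mean_pow by lia. ring.
    + intros j. unfold Cpoly. rewrite Csum_0. simpl. ring.
  - rewrite (circle_mean_ext _ _ _ (fun z => Cpoly w K z * z ^ m + w (S K) * z ^ (S K + m))%C).
    + rewrite circle_mean_plus, IH by lia. rewrite circle_mean_scal, circle_mean_pow by lia. ring.
    + intros j. unfold Cpoly. rewrite Csum_S, Cpow_add_r. ring.
Qed.

Lemma circle_mean_Cpoly (w : nat -> C) (K : nat) (r : R) (N : nat) :
  (K <= N)%nat -> circle_mean r N (Cpoly w K) = w O.
Proof.
  induction K as [|K IH]; intros HK.
  - rewrite (circle_mean_ext _ _ _ (fun z => w O)%C).
    + apply circle_mean_const.
    + intros j. unfold Cpoly. rewrite Csum_0. simpl. ring.
  - rewrite (circle_mean_ext _ _ _ (fun z => Cpoly w K z + w (S K) * z ^ (S K))%C).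
    + rewrite circle_mean_plus, IH by lia. rewrite circle_mean_scal, circle_mean_pow by lia. ring.
    + intros j. unfold Cpoly. rewrite Csum_S. ring.
Qed.

(* On the sample points z^(N+1) = r^(N+1), so conj(z)^n is r^(2n) z^(N+1-n) / r^(N+1). *)
Lemma circle_mean_Cpoly_conj (w : nat -> C) (K n : nat) (r : R) (N : nat) :
  0 < r -> (n <= K)%nat -> (K + n <= N)%nat ->
  circle_mean r N (fun z => Cpoly w K z * Cconj z ^ n)%C = (RtoC (r ^ (2 * n)) * w n)%C.
Proof.
  intros Hr HnK HN.
  assert (P : RtoC (r ^ S N) <> 0%C).
  { intros F. apply RtoC_inj in F. apply (pow_nonzero r (S N)); [lra|exact F]. }
  (* The case distinction lets the induction on [K] start below [n], where the mean is still 0. *)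
  assert (E : forall K, (K + n <= N)%nat ->
     circle_mean r N (fun z => Cpoly w K z * z ^ (S N - n))%C
       = if le_dec n K then (RtoC (r ^ S N) * w n)%C else 0%C).
  { clear K HnK HN.
    (* The exponent is N + 1 for k = n, between 1 and N for k < n, and N + 1 plus the number k - n
       in 1..N for k > n; only the first case has a non-zero mean. *)
    assert (M : forall k, (k + n <= N)%nat -> circle_mean r N (fun z => w k * z ^ (k + (S N - n)))%C
             = if Nat.eq_dec n k then (RtoC (r ^ S N) * w n)%C else 0%C).
    { intros k Hk. rewrite circle_mean_scal. destruct (Nat.eq_dec n k) as [<-|Hne].
      - rewrite (circle_mean_ext _ _ _ (fun z => RtoC (r ^ S N))).
        + rewrite circle_mean_const. ring.
        + intros j. replace (n + (S N - n))%nat with (S N) by lia. apply root_pt_pow.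
      - destruct (Nat.lt_ge_cases k n) as [Hlt|Hge].
        + rewrite circle_mean_pow by lia. ring.
        + rewrite (circle_mean_ext _ _ _ (fun z => RtoC (r ^ S N) * z ^ (k - n))%C).
          * rewrite circle_mean_scal, circle_mean_pow by lia. ring.
          * intros j. replace (k + (S N - n))%nat with (S N + (k - n))%nat by lia.
            rewrite Cpow_add_r, root_pt_pow. reflexivity. }
    induction K as [|K IH]; intros HK.
    - rewrite (circle_mean_ext _ _ _ (fun z => w O * z ^ (0 + (S N - n)))%C).
      + rewrite M by lia. destruct (Nat.eq_dec n 0), (le_dec n 0); try reflexivity; lia.
      + intros j. unfold Cpoly. rewrite Csum_0, Cpow_add_r. simpl (_ ^ 0)%C. ring.
    - rewrite (circle_mean_ext _ _ _ (fun z => Cpoly w K z * z ^ (S N - n)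
                 + w (S K) * z ^ (S K + (S N - n)))%C).
      + rewrite circle_mean_plus, IH, M by lia.
        destruct (Nat.eq_dec n (S K)), (le_dec n K), (le_dec n (S K)); try lia; ring.
      + intros j. unfold Cpoly. rewrite Csum_S, Cpow_add_r. ring. }
  rewrite (circle_mean_ext _ _ _
     (fun z => (RtoC (r ^ (2 * n)) / RtoC (r ^ S N)) * (Cpoly w K z * z ^ (S N - n)))%C).
  - rewrite circle_mean_scal, E by lia. destruct (le_dec n K); [|lia]. field. exact P.
  - intros j. set (z := root_pt r (S N) j).
    assert (Z : (z ^ n * Cconj z ^ n = RtoC (r ^ (2 * n)))%C).
    { rewrite <- Cpow_mult_l, <- Cmod2_conj. unfold z. rewrite Cmod_root_pt by lra.
      rewrite RtoC_pow, <- Cpow_mult_r, RtoC_pow. reflexivity. }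
    assert (Z2 : (z ^ n * z ^ (S N - n) = RtoC (r ^ S N))%C).
    { rewrite <- Cpow_add_r. replace (n + (S N - n))%nat with (S N) by lia. apply root_pt_pow. }
    rewrite <- Z. rewrite <- Z2 in P |- *. field.
    split; intros F; apply P; rewrite F; ring.
Qed.

(** * Coefficient bound *)

Lemma PS_eq_Cpoly_plus_tail (w : nat -> C) (rad : R) (z : C) (K : nat) :
  abs_conv_disc w rad -> Cmod z < rad ->
  abs_summable (fun k => w (S K + k)%nat * z ^ (S K + k))%C /\
  PS w z = (Cpoly w K z + CSeries (fun k => w (S K + k)%nat * z ^ (S K + k)))%C.
Proof.
  intros Hw Hz. pose proof (abs_conv_disc_summable w rad z Hw Hz) as S0.
  induction K as [|K [IH1 IH2]].
  - split; [now apply (proj1 (abs_summable_incr_1 _)) in S0|].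
    unfold PS, Cpoly. rewrite Csum_0. now rewrite (CSeries_incr_1 _ S0).
  - apply (proj1 (abs_summable_incr_1 _)) in IH1 as IH3.
    split.
    + revert IH3. apply abs_summable_ext. intros n.
      replace (S K + S n)%nat with (S (S K) + n)%nat by lia. reflexivity.
    + rewrite IH2, (CSeries_incr_1 _ IH1). unfold Cpoly. rewrite Csum_S.
      rewrite Nat.add_0_r, Cplus_assoc. f_equal. apply CSeries_ext. intros n.
      replace (S K + S n)%nat with (S (S K) + n)%nat by lia. reflexivity.
Qed.

Lemma Series_tail_small (a : nat -> R) (eps : R) :
  ex_series a -> 0 < eps ->
  exists N, forall n, (N <= n)%nat -> Rabs (Series (fun k => a (S n + k)%nat)) < eps.
Proof.
  intros Ha He. pose proof (Series_correct a Ha) as H.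
  destruct (H (ball (Series a) eps)) as [N HN].
  { exists (mkposreal _ He). intros y Hy; exact Hy. }
  exists N. intros n Hn. specialize (HN n Hn).
  change (Rabs (sum_n a n - Series a) < eps) in HN.
  rewrite (Series_incr_n a (S n)) in HN by (lia || exact Ha).
  rewrite sum_n_Reals in HN. simpl pred in HN.
  rewrite <- Rabs_Ropp. match goal with |- Rabs ?x < _ => match type of HN with Rabs ?y < _ => replace x with y by ring end end.
  exact HN.
Qed.

(** The tail is dominated by a real series that depends on |z| = r only, so one [N] serves the whole
    circle. *)
Lemma Cpoly_approx (w : nat -> C) (r eps : R) :
  abs_conv_disc w 1 -> 0 <= r < 1 -> 0 < eps ->
  exists N, forall K, (N <= K)%nat -> forall z, Cmod z = r ->
    Cmod (PS w z - Cpoly w K z)%C <= eps.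
Proof.
  intros Hw Hr He.
  destruct (Series_tail_small (fun k => Cmod (w k) * r ^ k) eps (Hw r Hr) He) as [N HN].
  exists N. intros K HK z Hz.
  destruct (PS_eq_Cpoly_plus_tail w 1 z K Hw ltac:(lra)) as [S1 E].
  rewrite E. replace (Cpoly w K z + CSeries (fun k => w (S K + k)%nat * z ^ (S K + k)) - Cpoly w K z)%C
    with (CSeries (fun k => w (S K + k)%nat * z ^ (S K + k)))%C by ring.
  eapply Rle_trans; [now apply Cmod_CSeries_le|].
  rewrite (Series_ext _ (fun k => Cmod (w (S K + k)%nat) * r ^ (S K + k))).
  - eapply Rle_trans; [apply Rle_abs|]. left. now apply HN.
  - intros n. now rewrite Cmod_mult, Cmod_pow, Hz.
Qed.

Lemma Re_plus (x y : C) : Re (x + y)%C = Re x + Re y.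
Proof. reflexivity. Qed.

(** Averaging over |z| = r removes the [q1] and [s1] terms, while [q0] selects w_0 and [qm] selects
    w_n. Since the means are computed for polynomials, [PS w] is truncated to within eps / (Q + 1),
    where [Q] bounds the multiplier of [PS w] on the circle; the 1 covers Q = 0. *)
Lemma mean_inequality (w : nat -> C) (r : R) (n : nat) (q0 q1 qm s1 : C) (s0 : R) :
  abs_conv_disc w 1 -> 0 < r < 1 -> (0 < n)%nat ->
  (forall z, Cmod z = r ->
     Re (PS w z * (q0 + q1 * z ^ n + qm * Cconj z ^ n))%C <= s0 + Re (s1 * z ^ n)%C) ->
  Re (w O * q0 + qm * (RtoC (r ^ (2 * n)) * w n))%C <= s0.
Proof.
  intros Hw Hr Hn H.
  set (Q := Cmod q0 + Cmod q1 + Cmod qm).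
  assert (HQ : 0 <= Q).
  { unfold Q. pose proof (Cmod_ge_0 q0). pose proof (Cmod_ge_0 q1). pose proof (Cmod_ge_0 qm). lra. }
  apply le_epsilon. intros eps He.
  assert (He' : 0 < eps / (Q + 1)) by (apply Rdiv_lt_0_compat; lra).
  destruct (Cpoly_approx w r (eps / (Q + 1)) Hw ltac:(lra) He') as [N0 HN0].
  set (K := Nat.max N0 n). specialize (HN0 K (Nat.le_max_l _ _)).
  (* The least [N] for which neither z^n nor conj(z)^n times a polynomial of degree [K] aliases on
     the N + 1 points. *)
  set (N := (K + n)%nat).
  set (F := fun z => (Cpoly w K z * (q0 + q1 * z ^ n + qm * Cconj z ^ n) + - s1 * z ^ n)%C).
  assert (M : circle_mean r N F = (w O * q0 + qm * (RtoC (r ^ (2 * n)) * w n))%C).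
  { unfold F.
    rewrite (circle_mean_ext _ _ _ (fun z => ((q0 * Cpoly w K z + q1 * (Cpoly w K z * z ^ n))
       + qm * (Cpoly w K z * Cconj z ^ n)) + - s1 * z ^ n)%C) by (intros; ring).
    rewrite !circle_mean_plus, !circle_mean_scal.
    rewrite (circle_mean_Cpoly w K r N) by lia.
    rewrite circle_mean_Cpoly_pow by lia.
    rewrite circle_mean_Cpoly_conj by (lra || lia).
    rewrite circle_mean_pow by lia. ring. }
  rewrite <- M. apply circle_mean_Re_le; [lra|].
  intros z Hz. specialize (H z Hz). specialize (HN0 z Hz).
  set (q := (q0 + q1 * z ^ n + qm * Cconj z ^ n)%C) in *.
  assert (Hq : Cmod q <= Q).
  { assert (Z : Cmod z ^ n <= 1).
    { rewrite Hz. rewrite <- (pow1 n). apply pow_incr. lra. }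
    unfold q, Q. eapply Rle_trans; [apply Cmod_triangle|].
    apply Rplus_le_compat.
    - eapply Rle_trans; [apply Cmod_triangle|]. apply Rplus_le_compat_l.
      rewrite Cmod_mult, Cmod_pow. pose proof (Cmod_ge_0 q1). nra.
    - rewrite Cmod_mult, Cmod_pow, Cmod_conj. pose proof (Cmod_ge_0 qm). nra. }
  unfold F. fold q.
  replace (Cpoly w K z * q + - s1 * z ^ n)%C
    with (PS w z * q + (- (s1 * z ^ n) + - ((PS w z - Cpoly w K z) * q)))%C by ring.
  rewrite !Re_plus.
  assert (X : - Re (((PS w z - Cpoly w K z) * q))%C <= eps).
  { pose proof (re_le_Cmod ((PS w z - Cpoly w K z) * q)%C) as A1.
    rewrite Cmod_mult in A1.
    assert (A2 : Cmod (PS w z - Cpoly w K z)%C * Cmod q <= eps / (Q + 1) * Q).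
    { apply Rmult_le_compat; auto using Cmod_ge_0. }
    assert (A3 : eps / (Q + 1) * Q <= eps).
    { replace eps with (eps / (Q + 1) * (Q + 1)) at 2 by (field; lra).
      apply Rmult_le_compat_l; lra. }
    apply Rabs_le_between in A1. lra. }
  change (Re (- (s1 * z ^ n))%C) with (- Re (s1 * z ^ n)%C).
  change (Re (- ((PS w z - Cpoly w K z) * q))%C) with (- Re ((PS w z - Cpoly w K z) * q)%C).
  lra.
Qed.

Lemma bernoulli_pow (d : R) (m : nat) : 0 <= d <= 1 -> 1 - INR m * d <= (1 - d) ^ m.
Proof.
  intros Hd. induction m as [|m IH]; [simpl; lra|].
  rewrite S_INR. simpl. pose proof (pos_INR m).
  assert ((1 - d) * (1 - INR m * d) <= (1 - d) * (1 - d) ^ m) by (apply Rmult_le_compat_l; lra).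
  nra.
Qed.

(** The limit r -> 1 made explicit: for r = 1 - d Bernoulli's inequality gives X - m d X <= Y, and
    [d] is chosen with m d X <= eps. The cap 1/2 keeps [r] inside (0, 1). *)
Lemma le_of_pow_mult_le (X Y : R) (m : nat) :
  0 <= X -> (forall r, 0 < r < 1 -> r ^ m * X <= Y) -> X <= Y.
Proof.
  intros HX H. apply le_epsilon. intros eps He.
  pose proof (pos_INR m).
  set (T := INR m * X + 1).
  assert (HT : 0 < T) by (unfold T; nra).
  set (d := Rmin (1 / 2) (eps / T)).
  assert (Hd : 0 < d) by (apply Rmin_pos; [lra|now apply Rdiv_lt_0_compat]).
  assert (Hd1 : d <= 1 / 2) by apply Rmin_l.
  assert (Hd2 : d * T <= eps).
  { replace eps with (eps / T * T) by (field; lra). apply Rmult_le_compat_r; [lra|apply Rmin_r]. }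
  specialize (H (1 - d) ltac:(lra)).
  pose proof (bernoulli_pow d m ltac:(lra)) as B.
  assert ((1 - INR m * d) * X <= (1 - d) ^ m * X) by (apply Rmult_le_compat_r; assumption).
  unfold T in Hd2. nra.
Qed.

(* Clunie's method: with p = 1 + v z^n and v = B w_n / c the coefficient of z^n in c p - B w p
   vanishes, so averaging |w p|^2 <= |c p - B w p|^2 over the circle isolates |w_n|. The term
   |w p|^2 is bounded below by 2 Re (w p conj(w_n z^n)) - |w_n z^n|^2, which leaves an
   inequality affine in w. *)
Lemma coef_bound (w : nat -> C) (c : C) (B : R) (n : nat) :
  abs_conv_disc w 1 -> w O = 0%C -> c <> 0%C -> -1 <= B <= 1 -> (0 < n)%nat ->
  (forall z, Cmod z < 1 -> Cmod (PS w z) <= Cmod (c - B * PS w z)%C) ->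
  Cmod (w n) <= Cmod c.
Proof.
  intros Hw Hw0 Hc HB Hn H.
  apply Rsqr_incr_0; try apply Cmod_ge_0. unfold Rsqr.
  apply (le_of_pow_mult_le _ _ (2 * n)); [pose proof (Cmod_ge_0 (w n)); nra|].
  intros r Hr. set (g := w n). set (v := (B * g / c)%C).
  assert (Hcv : (c * v = B * g)%C) by (unfold v; field; exact Hc).
  set (rho := r ^ (2 * n)).
  (* These constants collect, by powers of z^n and of its conjugate, the terms of the right-hand
     side of [Id] below, after |z^n|^2 has been replaced by [rho]. *)
  set (q0 := (RtoC (2 * (1 - B * B) * rho) * (Cconj g * v)
     + RtoC (2 * B * (1 + Cmod v ^ 2 * rho)) * Cconj c)%C).
  set (q1 := (RtoC (2 * B) * (Cconj c * v))%C).
  set (qm := (RtoC (2 * (1 - B * B)) * Cconj g + RtoC (2 * B) * (Cconj c * Cconj v))%C).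
  set (s0 := Cmod c ^ 2 * (1 + Cmod v ^ 2 * rho) + (1 - B * B) * Cmod g ^ 2 * rho).
  set (s1 := (RtoC (2 * Cmod c ^ 2) * v)%C).
  pose proof (mean_inequality w r n q0 q1 qm s1 s0 Hw Hr Hn) as I.
  assert (J : forall z, Cmod z = r ->
     Re (PS w z * (q0 + q1 * z ^ n + qm * Cconj z ^ n))%C <= s0 + Re (s1 * z ^ n)%C).
  { intros z Hz. specialize (H z ltac:(lra)).
    set (W := PS w z) in *.
    assert (HW : Cmod W ^ 2 <= Cmod (c - B * W)%C ^ 2)
      by (apply pow_incr; split; [apply Cmod_ge_0|exact H]).
    rewrite <- Cpow_conj.
    assert (Hrho : rho = Cmod (z ^ n)%C ^ 2).
    { rewrite Cmod_pow, Hz, <- pow_mult. unfold rho. f_equal. lia. }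
    set (Z := (z ^ n)%C) in *.
    set (p := (1 + v * Z)%C).
    (* The weight 1 - B^2 makes the terms in |W|^2 cancel, which is why the left-hand side is affine
       in [W]. Both summands on the right are non-negative, by |W| <= |c - B W| and |B| <= 1. *)
    assert (Id : s0 + Re (s1 * Z)%C - Re (W * (q0 + q1 * Z + qm * Cconj Z))%C
       = Cmod p ^ 2 * (Cmod (c - B * W)%C ^ 2 - Cmod W ^ 2)
         + (1 - B * B) * Cmod (W * p - g * Z)%C ^ 2).
    { unfold s0, s1, q0, q1, qm, p. rewrite Hrho, !Cmod2_alt.
      clearbody W Z v g. clear.
      destruct W as [a b], Z as [x y], v as [v1 v2], g as [g1 g2], c as [c1 c2].
      unfold Cmult, Cplus, Cminus, Copp, Cconj, RtoC, Re, Im; simpl. ring. }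
    assert (0 <= Cmod p ^ 2 * (Cmod (c - B * W)%C ^ 2 - Cmod W ^ 2))
      by (apply Rmult_le_pos; [apply pow2_ge_0|lra]).
    assert (0 <= (1 - B * B) * Cmod (W * p - g * Z)%C ^ 2)
      by (apply Rmult_le_pos; [nra|apply pow2_ge_0]).
    lra. }
  specialize (I J). rewrite Hw0 in I. fold g rho in I.
  (* By c v = B g the two parts of [qm] contribute 2 (1 - B^2) |g|^2 and 2 B^2 |g|^2, so [B] drops
     out. *)
  assert (E : Re (0 * q0 + qm * (RtoC rho * g))%C = 2 * rho * Cmod g ^ 2).
  { unfold qm. rewrite <- Cmult_conj, Hcv. rewrite !Cmod2_alt.
    clearbody g. clear. destruct g as [g1 g2].
    unfold Cmult, Cplus, Cminus, Copp, Cconj, RtoC, Re, Im; simpl. ring. }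
  rewrite E in I. unfold s0 in I.
  (* With this, [I] reads 2 rho |g|^2 <= |c|^2 + rho |g|^2: here too the terms in B^2 cancel. *)
  assert (E2 : Cmod c ^ 2 * Cmod v ^ 2 = B * B * Cmod g ^ 2).
  { rewrite <- Rpow_mult_distr, <- Cmod_mult, Hcv, Cmod_mult, Cmod_R, Rpow_mult_distr, <- Rsqr_pow2, <- Rsqr_abs.
    unfold Rsqr; ring. }
  replace (Cmod c ^ 2 * (1 + Cmod v ^ 2 * rho)) with (Cmod c ^ 2 + (Cmod c ^ 2 * Cmod v ^ 2) * rho) in I by ring.
  rewrite E2 in I. nra.
Qed.

(** * Euler's integral *)

Lemma increasing_lim_p_infty (F : R -> R) (M : R) :
  (forall s t, 0 < s -> s <= t -> F s <= F t) -> (forall t, 0 < t -> F t <= M) ->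
  exists l, filterlim F (Rbar_locally p_infty) (locally l) /\ forall t, 0 < t -> F t <= l.
Proof.
  intros Hinc HM.
  destruct (completeness (fun y => exists t, 0 < t /\ y = F t)) as [l [Hl1 Hl2]].
  - exists M. intros y [t [Ht ->]]. now apply HM.
  - exists (F 1), 1. split; [lra|reflexivity].
  - exists l. assert (B : forall t, 0 < t -> F t <= l) by (intros t Ht; apply Hl1; now exists t).
    split; [|exact B].
    intros P [eps HP]. unfold filtermap; simpl.
    assert (E : exists t0, 0 < t0 /\ l - eps < F t0).
    { apply Classical_Prop.NNPP. intros N. pose proof (cond_pos eps).
      assert (l <= l - eps); [|lra]. apply Hl2. intros y [t [Ht ->]].
      apply Rnot_lt_le. intros Hlt. apply N. now exists t. }
    destruct E as [t0 [Ht0 E]]. exists t0. intros t Ht. apply HP.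
    change (Rabs (F t - l) < eps). pose proof (B t ltac:(lra)).
    pose proof (Hinc t0 t Ht0 ltac:(lra)). apply Rabs_lt_between. lra.
Qed.

Lemma increasing_lim_at_right_0 (F : R -> R) (m : R) :
  (forall s t, 0 < s -> s <= t -> F s <= F t) -> (forall t, 0 < t -> m <= F t) ->
  exists l, filterlim F (at_right 0) (locally l) /\ forall t, 0 < t -> l <= F t.
Proof.
  intros Hinc Hm.
  destruct (completeness (fun y => exists t, 0 < t /\ y = - F t)) as [l [Hl1 Hl2]].
  - exists (- m). intros y [t [Ht ->]]. specialize (Hm t Ht). lra.
  - exists (- F 1), 1. split; [lra|reflexivity].
  - exists (- l).
    assert (B : forall t, 0 < t -> - l <= F t).
    { intros t Ht. assert (- F t <= l); [|lra]. apply Hl1. now exists t. }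
    split; [|exact B].
    intros P [eps HP]. unfold filtermap.
    assert (E : exists t0, 0 < t0 /\ F t0 < - l + eps).
    { apply Classical_Prop.NNPP. intros N. pose proof (cond_pos eps).
      assert (l <= l - eps); [|lra]. apply Hl2. intros y [t [Ht ->]].
      apply Rnot_lt_le. intros Hlt. apply N. exists t. split; [exact Ht|lra]. }
    destruct E as [t0 [Ht0 E]]. exists (mkposreal _ Ht0). intros t Ht Ht1.
    change (Rabs (t - 0) < t0) in Ht. apply Rabs_lt_between in Ht. apply HP.
    change (Rabs (F t - - l) < eps). pose proof (B t Ht1).
    pose proof (Hinc t t0 Ht1 ltac:(lra)). apply Rabs_lt_between. lra.
Qed.

(** Used twice: with the indefinite integral from 1, to get convergence, and with an explicit
    antiderivative, to evaluate Gamma(1/2). *)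
Lemma is_RInt_gen_antiderivative (f F : R -> R) (la lb : R) :
  (forall t, 0 < t -> is_derive F t (f t)) -> (forall t, 0 < t -> continuous f t) ->
  filterlim F (at_right 0) (locally la) ->
  filterlim F (Rbar_locally p_infty) (locally lb) ->
  is_RInt_gen f (at_right 0) (Rbar_locally p_infty) (lb - la).
Proof.
  intros HF Hf H0 H1 P [eps HP].
  assert (He : 0 < eps / 2) by (pose proof (cond_pos eps); lra).
  set (e2 := mkposreal _ He).
  apply (Filter_prod _ _ _ (fun a => 0 < a /\ ball la e2 (F a)) (fun b => 0 < b /\ ball lb e2 (F b))).
  - apply filter_and; [|apply H0; now exists e2].
    exists (mkposreal _ Rlt_0_1). now intros.
  - apply filter_and; [now exists 0|apply H1; now exists e2].
  - intros a b [Ha Ba] [Hb Bb]. simpl. exists (F b - F a). split.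
    + apply (is_RInt_derive F f).
      * intros x Hx. apply HF. eapply Rlt_le_trans; [|apply Hx]. now apply Rmin_glb_lt.
      * intros x Hx. apply Hf. eapply Rlt_le_trans; [|apply Hx]. now apply Rmin_glb_lt.
    + apply HP. change (Rabs (F a - la) < eps / 2) in Ba. change (Rabs (F b - lb) < eps / 2) in Bb.
      change (Rabs (F b - F a - (lb - la)) < eps).
      apply Rabs_lt_between in Ba. apply Rabs_lt_between in Bb. apply Rabs_lt_between. lra.
Qed.

Definition gamma_integrand (x t : R) : R := Rpower t (x - 1) * exp (- t).

Lemma gamma_integrand_pos (x t : R) : 0 < gamma_integrand x t.
Proof. apply Rmult_lt_0_compat; apply exp_pos. Qed.

Lemma continuous_gamma_integrand (x t : R) : 0 < t -> continuous (gamma_integrand x) t.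
Proof.
  intros Ht. apply (ex_derive_continuous (gamma_integrand x)).
  unfold gamma_integrand, Rpower. auto_derive. exact Ht.
Qed.

Lemma ex_RInt_gamma_integrand (x a b : R) : 0 < a -> 0 < b -> ex_RInt (gamma_integrand x) a b.
Proof.
  intros Ha Hb. apply (ex_RInt_continuous (gamma_integrand x)).
  intros z Hz. apply continuous_gamma_integrand.
  eapply Rlt_le_trans; [|apply Hz]. now apply Rmin_glb_lt.
Qed.

Lemma ln_le_sub_1 (u : R) : 0 < u -> ln u <= u - 1.
Proof. intros Hu. pose proof (exp_ineq1_le (ln u)). rewrite exp_ln in *; lra. Qed.

(** The inequality ln u <= u - 1 at u = t / (2k), with k = |y| + 1, gives k ln t <= k ln (2k) + t /
    2; the constant is (2k)^k. *)
Lemma Rpower_le_exp_half (y : R) :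
  exists C, 0 < C /\ forall t, 1 <= t -> Rpower t y <= C * exp (t / 2).
Proof.
  set (k := Rabs y + 1). pose proof (Rabs_pos y).
  assert (Hk : 0 < 2 * k) by (unfold k; lra).
  exists (exp (k * ln (2 * k))). split; [apply exp_pos|].
  intros t Ht. rewrite <- exp_plus. unfold Rpower.
  assert (L : 0 <= ln t) by (rewrite <- ln_1; apply ln_le; lra).
  assert (A : y * ln t <= k * ln t).
  { apply Rmult_le_compat_r; [exact L|]. pose proof (Rle_abs y). unfold k; lra. }
  assert (Hu : 0 < t / (2 * k)) by (apply Rdiv_lt_0_compat; lra).
  assert (B : ln t = ln (t / (2 * k)) + ln (2 * k)).
  { rewrite <- ln_mult by lra. f_equal. field. unfold k in *; lra. }
  pose proof (ln_le_sub_1 _ Hu) as D.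
  assert (E : k * (t / (2 * k)) = t / 2) by (field; unfold k in *; lra).
  assert (y * ln t <= k * ln (2 * k) + t / 2).
  { eapply Rle_trans; [exact A|]. rewrite B.
    assert (k * ln (t / (2 * k)) <= k * (t / (2 * k) - 1)) by (apply Rmult_le_compat_l; lra).
    lra. }
  destruct (Rle_lt_or_eq_dec _ _ H0) as [H1|H1]; [left; now apply exp_increasing|rewrite H1; lra].
Qed.

Lemma exp_le (x y : R) : x <= y -> exp x <= exp y.
Proof. intros [H| ->]; [left; now apply exp_increasing|lra]. Qed.

Lemma gamma_integrand_le_near_0 (x t : R) :
  1 / 2 <= x -> 0 < t <= 1 -> gamma_integrand x t <= exp (- (1 / 2) * ln t).
Proof.
  intros Hx Ht. unfold gamma_integrand, Rpower. rewrite <- exp_plus. apply exp_le.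
  assert (ln t <= 0) by (rewrite <- ln_1; apply ln_le; lra). nra.
Qed.

(** The majorant s^(-1/2), available because x >= 1/2, has antiderivative 2 sqrt s; hence the bound
    2. *)
Lemma RInt_gamma_integrand_0_1 (x t : R) :
  1 / 2 <= x -> 0 < t <= 1 -> RInt (gamma_integrand x) t 1 <= 2.
Proof.
  intros Hx Ht.
  assert (I : is_RInt (fun s => exp (- (1 / 2) * ln s)) t 1
     (2 * exp (1 / 2 * ln 1) - 2 * exp (1 / 2 * ln t))).
  { apply (is_RInt_derive (fun s => 2 * exp (1 / 2 * ln s))); rewrite Rmin_left, Rmax_right by lra.
    - intros s Hs. auto_derive; [lra|].
      replace (- (1 / 2) * ln s) with (1 / 2 * ln s + - ln s) by field.
      rewrite exp_plus, exp_Ropp, exp_ln by lra. field. lra.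
    - intros s Hs. apply (ex_derive_continuous (fun s => exp (- (1 / 2) * ln s))). auto_derive. lra. }
  apply Rle_trans with (RInt (fun s => exp (- (1 / 2) * ln s)) t 1).
  - apply RInt_le; [lra|apply ex_RInt_gamma_integrand; lra|eexists; exact I|].
    intros s Hs. apply gamma_integrand_le_near_0; lra.
  - rewrite (is_RInt_unique _ _ _ _ I). rewrite ln_1, Rmult_0_r, exp_0.
    pose proof (exp_pos (1 / 2 * ln t)). lra.
Qed.

Lemma RInt_gamma_integrand_1_infty (x : R) :
  exists M, forall t, 1 <= t -> RInt (gamma_integrand x) 1 t <= M.
Proof.
  destruct (Rpower_le_exp_half (x - 1)) as [C [HC HB]].
  exists (2 * C). intros t Ht.
  assert (I : is_RInt (fun s => C * exp (- s / 2)) 1 t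
     (- (2 * C) * exp (- t / 2) - - (2 * C) * exp (- 1 / 2))).
  { apply (is_RInt_derive (fun s => - (2 * C) * exp (- s / 2))).
    - intros s Hs. auto_derive; [exact I|]. unfold Rdiv. field.
    - intros s Hs. apply (ex_derive_continuous (fun s => C * exp (- s / 2))). auto_derive. exact I. }
  apply Rle_trans with (RInt (fun s => C * exp (- s / 2)) 1 t).
  - apply RInt_le; [lra|apply ex_RInt_gamma_integrand; lra|eexists; exact I|].
    intros s Hs. unfold gamma_integrand.
    replace (C * exp (- s / 2)) with (C * exp (s / 2) * exp (- s)).
    + apply Rmult_le_compat_r; [left; apply exp_pos|apply HB; lra].
    + rewrite Rmult_assoc, <- exp_plus. do 2 f_equal. field.
  - rewrite (is_RInt_unique _ _ _ _ I). pose proof (exp_pos (- t / 2)).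
    assert (exp (- 1 / 2) <= 1) by (rewrite <- exp_0; apply exp_le; lra). nra.
Qed.

(** The integrand is positive, so the integral from 1 is monotone in its end point; it is bounded on
    both sides and therefore has limits there. The second part turns bounds on a compact interval
    into lower bounds for [Gamma]. *)
Lemma gamma_converges (x : R) :
  1 / 2 <= x ->
  is_RInt_gen (gamma_integrand x) (at_right 0) (Rbar_locally p_infty) (Gamma x) /\
  forall a b, 0 < a -> a <= b -> RInt (gamma_integrand x) a b <= Gamma x.
Proof.
  intros Hx. set (F := fun t => RInt (gamma_integrand x) 1 t).
  assert (Ch : forall s t, 0 < s -> 0 < t -> F t - F s = RInt (gamma_integrand x) s t).
  { intros s t Hs Ht. unfold F.
    rewrite <- (RInt_Chasles (gamma_integrand x) 1 s t); [|apply ex_RInt_gamma_integrand; lra..].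
    unfold plus; simpl. ring. }
  assert (Hinc : forall s t, 0 < s -> s <= t -> F s <= F t).
  { intros s t Hs Ht. assert (0 <= RInt (gamma_integrand x) s t).
    { apply RInt_ge_0; [exact Ht|apply ex_RInt_gamma_integrand; lra|].
      intros; left; apply gamma_integrand_pos. }
    rewrite <- Ch in H; lra. }
  destruct (RInt_gamma_integrand_1_infty x) as [M HM].
  destruct (increasing_lim_p_infty F M Hinc) as [lb [Hlb1 Hlb2]].
  { intros t Ht. apply Rle_trans with (F (Rmax 1 t)); [apply Hinc; [exact Ht|apply Rmax_r]|].
    apply HM, Rmax_l. }
  destruct (increasing_lim_at_right_0 F (- 2) Hinc) as [la [Hla1 Hla2]].
  { intros t Ht. apply Rle_trans with (F (Rmin 1 t)).
    - pose proof (Rmin_l 1 t). assert (0 < Rmin 1 t) by (apply Rmin_pos; lra).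
      pose proof (RInt_gamma_integrand_0_1 x (Rmin 1 t) Hx ltac:(lra)) as B.
      rewrite <- Ch in B by lra. unfold F in B at 1. rewrite RInt_point in B.
      change (0 - F (Rmin 1 t) <= 2) in B. lra.
    - apply Hinc; [apply Rmin_pos; lra|apply Rmin_r]. }
  assert (G : is_RInt_gen (gamma_integrand x) (at_right 0) (Rbar_locally p_infty) (lb - la)).
  { apply (is_RInt_gen_antiderivative _ F); [| |exact Hla1|exact Hlb1].
    - intros t Ht. apply (is_derive_RInt _ _ 1); [|now apply continuous_gamma_integrand].
      exists (mkposreal _ Ht). intros y Hy. change (Rabs (y - t) < t) in Hy.
      apply Rabs_lt_between in Hy. unfold F.
      apply (RInt_correct (gamma_integrand x)), ex_RInt_gamma_integrand; lra.
    - intros t Ht. now apply continuous_gamma_integrand. }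
  assert (E : Gamma x = lb - la) by (apply (is_RInt_gen_unique (gamma_integrand x)); exact G).
  rewrite E. split; [exact G|].
  intros a b Ha Hb. rewrite <- Ch by lra.
  pose proof (Hlb2 b ltac:(lra)). pose proof (Hla2 a Ha). lra.
Qed.

(** On [1, 2] one has t^(x-1) >= 1/t >= 1/2 and e^(-t) >= e^(-2). The bound is uniform in [x], which
    allows an additive constant to be absorbed into a multiple of Gamma in [bs_coef_bound]. *)
Lemma Gamma_lower_bound (x : R) : 1 / 2 <= x -> exp (- 2) / 2 <= Gamma x.
Proof.
  intros Hx. destruct (gamma_converges x Hx) as [_ H].
  eapply Rle_trans; [|apply (H 1 2); lra].
  assert (I : is_RInt (fun _ : R => exp (- 2) / 2) 1 2 ((2 - 1) * (exp (- 2) / 2)))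
    by apply (is_RInt_const 1 2 (exp (- 2) / 2)).
  apply Rle_trans with (RInt (fun _ => exp (- 2) / 2) 1 2).
  - rewrite (is_RInt_unique _ _ _ _ I). lra.
  - apply RInt_le; [lra|eexists; exact I|apply ex_RInt_gamma_integrand; lra|].
    intros t Ht. unfold gamma_integrand.
    assert (A : exp (- 2) <= exp (- t)) by (apply exp_le; lra).
    assert (B : / 2 <= Rpower t (x - 1)).
    { apply Rle_trans with (/ t); [apply Rinv_le_contravar; lra|].
      rewrite <- (exp_ln t) at 1 by lra. rewrite <- exp_Ropp. apply exp_le.
      assert (0 <= ln t) by (rewrite <- ln_1; apply ln_le; lra). nra. }
    pose proof (exp_pos (- 2)). unfold Rdiv. rewrite Rmult_comm.
    apply Rmult_le_compat; lra.
Qed.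

Lemma Gamma_pos (x : R) : 1 / 2 <= x -> 0 < Gamma x.
Proof.
  intros Hx. eapply Rlt_le_trans; [|now apply Gamma_lower_bound].
  pose proof (exp_pos (- 2)); lra.
Qed.

(** Gamma decreases before it increases, so plain monotonicity fails on [1/2, infinity). For t >= 1
    the power t^(x-1) is at most t^(y-1), and for t < 1 it is at most t^(-1/2); the second part
    costs Gamma(1/2). *)
Lemma Gamma_quasi_increasing (x y : R) :
  1 / 2 <= x -> x <= y -> Gamma x <= Gamma y + Gamma (1 / 2).
Proof.
  intros Hx Hxy.
  destruct (gamma_converges x Hx) as [Gx _].
  destruct (gamma_converges y ltac:(lra)) as [Gy _].
  destruct (gamma_converges (1 / 2) ltac:(lra)) as [Gh _].
  pose proof (is_RInt_gen_plus _ _ _ _ Gy Gh) as Gs.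
  assert (N : norm (Gamma x) <= plus (Gamma y) (Gamma (1 / 2))).
  { refine (RInt_gen_norm _ _ _ _ _ _ Gx Gs).
    - apply (Filter_prod _ _ _ (fun a => a < 1) (fun b => 1 < b)).
      + exists (mkposreal _ Rlt_0_1). intros a Ha _. change (Rabs (a - 0) < 1) in Ha.
        apply Rabs_lt_between in Ha. lra.
      + now exists 1.
      + intros a b Ha Hb; simpl; lra.
    - apply (Filter_prod _ _ _ (fun a => 0 < a) (fun b => 0 < b)).
      + exists (mkposreal _ Rlt_0_1). now intros.
      + now exists 0.
      + intros a b Ha Hb t Ht. simpl in Ht. 
        change (Rabs (gamma_integrand x t) <= gamma_integrand y t + gamma_integrand (1 / 2) t).
        rewrite Rabs_pos_eq by (left; apply gamma_integrand_pos).
        unfold gamma_integrand. rewrite <- Rmult_plus_distr_r.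
        apply Rmult_le_compat_r; [left; apply exp_pos|]. unfold Rpower.
        destruct (Rle_dec 1 t).
        * assert (0 <= ln t) by (rewrite <- ln_1; apply ln_le; lra).
          assert (exp ((x - 1) * ln t) <= exp ((y - 1) * ln t)) by (apply exp_le; nra).
          pose proof (exp_pos ((1 / 2 - 1) * ln t)). lra.
        * assert (ln t <= 0) by (rewrite <- ln_1; apply ln_le; lra).
          assert (exp ((x - 1) * ln t) <= exp ((1 / 2 - 1) * ln t)) by (apply exp_le; nra).
          pose proof (exp_pos ((y - 1) * ln t)). lra. }
  eapply Rle_trans; [apply Rle_abs|exact N].
Qed.

(** * The Gaussian integral *)

Definition gauss_int (x : R) : R := RInt (fun s => exp (- (s * s))) 0 x.

(** Differentiation in [x] cancels the denominator and leaves a Gaussian in x u, up to factors that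
    do not involve u. *)
Definition gauss_kernel (x u : R) : R := exp (- (x * x * (1 + u * u))) / (1 + u * u).

Lemma one_plus_sqr_pos (u : R) : 0 < 1 + u * u.
Proof. nra. Qed.

Lemma ex_RInt_gauss (a b : R) : ex_RInt (fun s => exp (- (s * s))) a b.
Proof.
  apply (ex_RInt_continuous (fun s => exp (- (s * s)))). intros z _.
  apply (ex_derive_continuous (fun s => exp (- (s * s)))). auto_derive. exact I.
Qed.

Lemma is_derive_gauss_int (x : R) : is_derive gauss_int x (exp (- (x * x))).
Proof.
  apply (is_derive_RInt (fun s => exp (- (s * s))) gauss_int 0).
  - apply filter_forall. intros y. apply (RInt_correct (fun s => exp (- (s * s)))), ex_RInt_gauss.
  - apply (ex_derive_continuous (fun s => exp (- (s * s)))). auto_derive. exact I.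
Qed.

Lemma ex_RInt_gauss_kernel (x a b : R) : ex_RInt (gauss_kernel x) a b.
Proof.
  apply (ex_RInt_continuous (gauss_kernel x)). intros u _.
  apply (ex_derive_continuous (gauss_kernel x)). unfold gauss_kernel. auto_derive.
  pose proof (one_plus_sqr_pos u). lra.
Qed.

Lemma is_derive_gauss_kernel (x u : R) :
  is_derive (fun y => gauss_kernel y u) x (- (2 * x) * exp (- (x * x * (1 + u * u)))).
Proof.
  unfold gauss_kernel. pose proof (one_plus_sqr_pos u).
  auto_derive; [lra|]. field. lra.
Qed.

(** Differentiation under the integral sign, followed by the substitution s = x u, which turns the
    integral over [0, 1] into [gauss_int x]. *)
Lemma is_derive_RInt_gauss_kernel (x : R) :
  is_derive (fun y => RInt (gauss_kernel y) 0 1) x (- (2 * exp (- (x * x)) * gauss_int x)).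
Proof.
  assert (D : forall y u, Derive (fun z => gauss_kernel z u) y = - (2 * y) * exp (- (y * y * (1 + u * u)))).
  { intros y u. apply is_derive_unique, is_derive_gauss_kernel. }
  replace (- (2 * exp (- (x * x)) * gauss_int x))
    with (RInt (fun u => Derive (fun y => gauss_kernel y u) x) 0 1).
  - apply (is_derive_RInt_param gauss_kernel 0 1 x).
    + apply filter_forall. intros y u _. eexists. apply is_derive_gauss_kernel.
    + intros u _.
      apply continuity_2d_pt_ext with (fun y t => - (2 * y) * exp (- (y * y * (1 + t * t)))).
      { intros y t. symmetry. apply D. }
      apply continuity_2d_pt_mult.
      * apply continuity_2d_pt_opp, continuity_2d_pt_mult;
          [apply continuity_2d_pt_const|apply continuity_2d_pt_id1].
      * apply (continuity_1d_2d_pt_comp exp (fun y t => - (y * y * (1 + t * t)))).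
        { apply derivable_continuous_pt, derivable_pt_exp. }
        apply continuity_2d_pt_opp. apply continuity_2d_pt_mult.
        { apply continuity_2d_pt_mult; apply continuity_2d_pt_id1. }
        apply continuity_2d_pt_plus; [apply continuity_2d_pt_const|].
        apply continuity_2d_pt_mult; apply continuity_2d_pt_id2.
    + apply filter_forall. intros y. apply ex_RInt_gauss_kernel.
  - apply is_RInt_unique.
    (* The summand 0 is the constant term of the affine substitution in [is_RInt_comp_lin]. *)
    assert (A : is_RInt (fun u => scal x (exp (- ((x * u + 0) * (x * u + 0))))) 0 1 (gauss_int x)).
    { apply (is_RInt_comp_lin (fun s => exp (- (s * s))) x 0 0 1).
      rewrite Rmult_0_r, Rmult_1_r, !Rplus_0_r.
      apply (RInt_correct (fun s => exp (- (s * s)))), ex_RInt_gauss. }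
    apply (is_RInt_scal _ _ _ (- (2 * exp (- (x * x))))) in A.
    replace (- (2 * exp (- (x * x)) * gauss_int x)) with (scal (- (2 * exp (- (x * x)))) (gauss_int x))
      by (unfold scal; simpl; unfold mult; simpl; ring).
    revert A. apply is_RInt_ext. intros u _. rewrite D. unfold scal; simpl; unfold mult; simpl.
    replace (- (x * x * (1 + u * u))) with (- (x * x) + - ((x * u + 0) * (x * u + 0))) by ring.
    rewrite exp_plus. ring.
Qed.

Lemma gauss_int_0 : gauss_int 0 = 0.
Proof. apply (RInt_point (V:=R_CompleteNormedModule)). Qed.

(* The left-hand side has zero derivative, so it is int_0^1 du / (1 + u^2). *)
Lemma gauss_int_sqr (x : R) :
  0 <= x -> gauss_int x ^ 2 + RInt (gauss_kernel x) 0 1 = PI / 4.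
Proof.
  intros Hx. set (H := fun y => gauss_int y ^ 2 + RInt (gauss_kernel y) 0 1).
  assert (H0 : H 0 = PI / 4).
  { unfold H. rewrite gauss_int_0.
    assert (A : is_RInt (fun u => / (1 + Rsqr u)) 0 1 (atan 1 - atan 0)).
    { apply (is_RInt_derive atan (fun u => / (1 + Rsqr u))).
      - intros u _. apply is_derive_atan.
      - intros u _. apply (ex_derive_continuous (fun u => / (1 + Rsqr u))).
        unfold Rsqr. auto_derive. pose proof (one_plus_sqr_pos u). lra. }
    rewrite (RInt_ext _ (fun u => / (1 + Rsqr u))).
    - rewrite (is_RInt_unique _ _ _ _ A). rewrite atan_1, atan_0. ring.
    - intros u _. unfold gauss_kernel, Rsqr. replace (- (0 * 0 * (1 + u * u))) with 0 by ring.
      rewrite exp_0. apply Rmult_1_l. }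
  destruct (Req_dec x 0) as [->|Hx0]; [exact H0|].
  change (H x = PI / 4). rewrite <- H0. symmetry. apply (eq_is_derive H); [|lra].
  intros t _. unfold H.
  assert (P : is_derive (fun y => gauss_int y ^ 2) t (2 * gauss_int t * exp (- (t * t)))).
  { replace (2 * gauss_int t * exp (- (t * t)))
      with (INR 2 * exp (- (t * t)) * gauss_int t ^ Init.Nat.pred 2) by (simpl; ring).
    apply is_derive_pow, is_derive_gauss_int. }
  pose proof (is_derive_plus _ _ _ _ _ P (is_derive_RInt_gauss_kernel t)) as Q.
  assert (Z : 2 * gauss_int t * exp (- (t * t)) + - (2 * exp (- (t * t)) * gauss_int t) = 0) by ring.
  exact (eq_ind _ (fun l => is_derive _ t l) Q _ Z).
Qed.

(** Any bound tending to 0 would serve; this one follows from e^y >= 1 + y >= x for y = x^2 (1 +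
    u^2). *)
Lemma RInt_gauss_kernel_bound (x : R) :
  0 < x -> 0 <= RInt (gauss_kernel x) 0 1 <= / x.
Proof.
  intros Hx. split.
  - apply RInt_ge_0; [lra|apply ex_RInt_gauss_kernel|]. intros u _.
    apply Rlt_le, Rdiv_lt_0_compat; [apply exp_pos|apply one_plus_sqr_pos].
  - assert (I : is_RInt (fun _ : R => / x) 0 1 ((1 - 0) * / x)) by apply (is_RInt_const 0 1 (/ x)).
    replace (/ x) with ((1 - 0) * / x) by ring. rewrite <- (is_RInt_unique _ _ _ _ I).
    apply RInt_le; [lra|apply ex_RInt_gauss_kernel|eexists; exact I|].
    intros u Hu. unfold gauss_kernel. rewrite exp_Ropp.
    pose proof (one_plus_sqr_pos u) as P.
    pose proof (exp_ineq1_le (x * x * (1 + u * u))) as X.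
    assert (x <= exp (x * x * (1 + u * u)) * (1 + u * u)).
    { assert (x <= 1 + x * x * (1 + u * u)) by nra.
      assert (1 + x * x * (1 + u * u) <= exp (x * x * (1 + u * u)) * (1 + u * u)) by nra. lra. }
    unfold Rdiv. rewrite <- Rinv_mult. apply Rinv_le_contravar; lra.
Qed.

Lemma gauss_int_lim : filterlim gauss_int (Rbar_locally p_infty) (locally (sqrt PI / 2)).
Proof.
  set (s := sqrt PI / 2).
  assert (Hs : 0 < s) by (apply Rdiv_lt_0_compat; [apply sqrt_lt_R0, PI_RGT_0|lra]).
  assert (Hs2 : s ^ 2 = PI / 4).
  { unfold s. pose proof (sqrt_sqrt PI ltac:(pose proof PI_RGT_0; lra)). simpl. lra. }
  intros P [eps HP]. unfold filtermap; simpl. pose proof (cond_pos eps).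
  (* Beyond this threshold |gauss_int x^2 - s^2| <= 1/x < s eps, and dividing by gauss_int x + s >=
     s gives the claim. *)
  exists (/ (s * eps)). intros x Hx. apply HP.
  change (Rabs (gauss_int x - s) < eps).
  assert (Hse : 0 < s * eps) by (apply Rmult_lt_0_compat; lra).
  assert (Hx0 : 0 < x) by (eapply Rlt_trans; [apply Rinv_0_lt_compat, Hse|exact Hx]).
  pose proof (gauss_int_sqr x ltac:(lra)) as E. pose proof (RInt_gauss_kernel_bound x Hx0) as B.
  assert (G : 0 <= gauss_int x).
  { apply RInt_ge_0; [lra|apply ex_RInt_gauss|]. intros; left; apply exp_pos. }
  assert (L : / x < s * eps).
  { rewrite <- (Rinv_inv (s * eps)). apply Rinv_lt_contravar; [|exact Hx].
    apply Rmult_lt_0_compat; [apply Rinv_0_lt_compat, Hse|exact Hx0]. }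
  rewrite <- Hs2 in E. apply Rabs_lt_between. split; nra.
Qed.

(** The substitution t = s^2 in Euler's integral: 2 gauss_int (sqrt t) is an antiderivative of the
    integrand, with limits 0 at 0 and sqrt PI at infinity. *)
Lemma Gamma_half : Gamma (1 / 2) = sqrt PI.
Proof.
  apply (is_RInt_gen_unique (gamma_integrand (1 / 2))).
  replace (sqrt PI) with (2 * (sqrt PI / 2) - 0) by field.
  apply (is_RInt_gen_antiderivative _ (fun t => 2 * gauss_int (sqrt t))).
  - intros t Ht. pose proof (sqrt_lt_R0 t Ht) as Hq.
    replace (gamma_integrand (1 / 2) t) with (scal 2 (scal (/ (2 * sqrt t)) (exp (- (sqrt t * sqrt t))))).
    + apply (is_derive_scal (fun t => gauss_int (sqrt t))).
      apply (is_derive_comp gauss_int sqrt); [apply is_derive_gauss_int|].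
      apply is_derive_Reals. now apply derivable_pt_lim_sqrt.
    + rewrite sqrt_sqrt by lra. unfold gamma_integrand, Rpower.
      replace ((1 / 2 - 1) * ln t) with (- (/ 2 * ln t)) by field.
      rewrite (exp_Ropp (/ 2 * ln t)). change (exp (/ 2 * ln t)) with (Rpower t (/ 2)).
      rewrite Rpower_sqrt by exact Ht.
      unfold scal; simpl; unfold mult; simpl. field. lra.
  - intros t Ht. now apply continuous_gamma_integrand.
  - assert (L : continuous (fun t => 2 * gauss_int (sqrt t)) 0).
    { apply (continuous_scal_r 2 (fun t => gauss_int (sqrt t)) 0).
      apply (continuous_comp sqrt gauss_int 0); [apply continuous_sqrt|].
      apply (ex_derive_continuous gauss_int). eexists. apply is_derive_gauss_int. }
    unfold continuous in L. rewrite sqrt_0, gauss_int_0, Rmult_0_r in L.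
    intros P HP. destruct (L P HP) as [eps He]. exists eps. intros y Hy _. now apply He.
  - apply (filterlim_comp _ _ _ (fun t => gauss_int (sqrt t)) (fun y => 2 * y) _ (locally (sqrt PI / 2))).
    + apply (filterlim_comp _ _ _ sqrt gauss_int _ (Rbar_locally p_infty)); [|apply gauss_int_lim].
      exact filterlim_sqrt_p.
    + apply (continuous_scal_r (U:=R_UniformSpace) (V:=R_NormedModule) 2 (fun y : R => y) (sqrt PI / 2)).
      apply continuous_id.
Qed.

(** * A coefficient criterion *)

Section Coefficient_criterion.

Variables (alpha lambda : R) (b : nat -> C) (g : C -> C).
Hypotheses (halpha : 0 <= alpha < 1) (hlambda : 0 <= lambda) (b0 : b 0%nat = 0%C) (b1 : b 1%nat = 1%C).
Hypothesis hg : forall z, Cmod z < 1 -> g z = PS b z.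

(** With n = k + 2 this is (n - alpha) |e_n|, where e_n = n (1 + lambda (n - 1)) b_n is the
    coefficient [den_coef n] of [L_den]. *)
Let weight (k : nat) : R :=
  (INR k + 2 - alpha) * ((INR k + 2) * (1 + lambda * (INR k + 1)) * Cmod (b (k + 2))).

Hypotheses (hex : ex_series weight) (hsum : Series weight <= 1 - alpha).

(** The first bound yields sum n |b_n| <= 1 for univalence, the second yields convergence on the
    disc. Both rest on n - alpha >= 1 and 1 + lambda (n - 1) >= 1. *)
Lemma Cmod_coef_le_weight (k : nat) :
  (1 - alpha) * ((INR k + 2) * Cmod (b (k + 2))) <= weight k /\ Cmod (b (k + 2)) <= weight k.
Proof.
  unfold weight. pose proof (Cmod_ge_0 (b (k + 2))) as P. pose proof (pos_INR k) as K.
  set (m := Cmod _) in *. set (x := INR k) in *.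
  assert (1 <= 1 + lambda * (x + 1)) by nra.
  assert (H1 : (x + 2) * m <= (x + 2) * (1 + lambda * (x + 1)) * m).
  { apply Rmult_le_compat_r; [exact P|]. nra. }
  assert (0 <= (x + 2) * m) by nra.
  assert (1 <= x + 2 - alpha) by lra.
  set (q := (x + 2) * (1 + lambda * (x + 1)) * m) in *.
  split; nra.
Qed.

Lemma abs_conv_coef : abs_conv_disc b 1.
Proof.
  intros r Hr.
  apply (ex_series_incr_n (K:=R_AbsRing) (V:=R_NormedModule) _ 2).
  apply ex_series_le_nonneg with weight; [|exact hex].
  intros k. replace (2 + k)%nat with (k + 2)%nat by lia.
  destruct (Cmod_coef_le_weight k) as [_ H]. pose proof (Cmod_ge_0 (b (k + 2))).
  assert (0 <= r ^ (k + 2) <= 1).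
  { split; [apply pow_le; lra|]. rewrite <- (pow1 (k + 2)). apply pow_incr; lra. }
  nra.
Qed.

Lemma PS_two_terms (u : nat -> C) (z : C) :
  abs_conv_disc u 1 -> Cmod z < 1 ->
  abs_summable (fun k => u (k + 2)%nat * z ^ (k + 2))%C /\
  PS u z = (u 0%nat + u 1%nat * z + CSeries (fun k => u (k + 2)%nat * z ^ (k + 2)))%C.
Proof.
  intros Hu Hz. destruct (PS_eq_Cpoly_plus_tail u 1 z 1 Hu Hz) as [S1 E].
  split.
  - revert S1. apply abs_summable_ext. intros k. now replace (2 + k)%nat with (k + 2)%nat by lia.
  - rewrite E. unfold Cpoly. rewrite Csum_S, Csum_0. f_equal; [simpl; ring|].
    apply CSeries_ext. intros k. now replace (2 + k)%nat with (k + 2)%nat by lia.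
Qed.

(** If g z = g w, then z - w is the sum of the b_n (w^n - z^n) over n >= 2, so |z - w| <= rho |z -
    w| sum n |b_n| <= rho |z - w| with rho = max(|z|, |w|) < 1. *)
Lemma coef_univalent : univalent_on_disc g.
Proof.
  intros z w Hz Hw E. unfold unit_disc in *. rewrite !hg in E by assumption.
  destruct (PS_two_terms b z abs_conv_coef Hz) as [Sz Ez].
  destruct (PS_two_terms b w abs_conv_coef Hw) as [Sw Ew].
  rewrite Ez, Ew, b0, b1 in E.
  set (rho := Rmax (Cmod z) (Cmod w)).
  assert (Hrho : 0 <= rho < 1).
  { split; [eapply Rle_trans; [apply Cmod_ge_0|apply Rmax_l]|now apply Rmax_lub_lt]. }
  set (v := fun k => (RtoC (-1) * (b (k + 2)%nat * z ^ (k + 2)) + b (k + 2)%nat * w ^ (k + 2))%C).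
  assert (D : (z - w)%C = CSeries v).
  { unfold v. rewrite CSeries_plus, CSeries_scal; [|exact Sz|now apply abs_summable_scal|exact Sw].
    replace (CSeries (fun k => b (k + 2)%nat * w ^ (k + 2)))%C
      with (z - w + CSeries (fun k => b (k + 2)%nat * z ^ (k + 2)))%C; [ring|].
    transitivity (0 + 1 * z + CSeries (fun k => b (k + 2)%nat * z ^ (k + 2)) - w)%C; [ring|].
    rewrite E. ring. }
  set (c := fun k => (INR k + 2) * Cmod (b (k + 2))).
  assert (Sc : ex_series c).
  { apply ex_series_le_nonneg with (fun k => / (1 - alpha) * weight k).
    - intros k. unfold c. split.
      + apply Rmult_le_pos; [pose proof (pos_INR k); lra|apply Cmod_ge_0].
      + apply Rmult_le_reg_l with (1 - alpha); [lra|].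
        replace ((1 - alpha) * (/ (1 - alpha) * weight k)) with (weight k) by (field; lra). apply Cmod_coef_le_weight.
    - now apply ex_series_Rmult_l. }
  assert (Hc : Series c <= 1).
  { apply Rmult_le_reg_l with (1 - alpha); [lra|]. rewrite <- Series_scal_l.
    apply Rle_trans with (Series weight); [|lra].
    apply Series_le; [|exact hex]. intros k. split; [|apply Cmod_coef_le_weight].
    apply Rmult_le_pos; [lra|]. apply Rmult_le_pos; [pose proof (pos_INR k); lra|apply Cmod_ge_0]. }
  pose proof (Cmod_ge_0 (z - w)%C) as Pd.
  assert (B : forall k, Cmod (v k) <= (rho * Cmod (z - w)%C) * c k).
  { intros k. unfold v, c.
    replace (RtoC (-1) * (b (k + 2)%nat * z ^ (k + 2)) + b (k + 2)%nat * w ^ (k + 2))%C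
      with (- (b (k + 2)%nat * (z ^ (k + 2) - w ^ (k + 2))))%C by ring.
    rewrite Cmod_opp, Cmod_mult.
    pose proof (Cpow_lipschitz z w rho (k + 1) (Rmax_l _ _) (Rmax_r _ _)) as L.
    replace (S (k + 1)) with (k + 2)%nat in L by lia. rewrite plus_INR in L. simpl (INR 2) in L.
    assert (0 <= rho ^ k <= 1).
    { split; [apply pow_le; lra|]. rewrite <- (pow1 k). apply pow_incr; lra. }
    assert (rho ^ (k + 1) <= rho) by (rewrite pow_add; simpl; nra).
    pose proof (pos_INR k). pose proof (Cmod_ge_0 (b (k + 2))).
    replace (rho * Cmod (z - w) * ((INR k + 2) * Cmod (b (k + 2))))
      with (Cmod (b (k + 2)) * ((INR k + 2) * rho * Cmod (z - w)%C)) by ring.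
    apply Rmult_le_compat_l; [assumption|]. eapply Rle_trans; [exact L|].
    apply Rmult_le_compat_r; [exact Pd|]. nra. }
  assert (F : Cmod (z - w)%C <= rho * Cmod (z - w)%C).
  { rewrite D at 1.
    pose proof (ex_series_Rmult_l (rho * Cmod (z - w)%C) c Sc) as X.
    eapply Rle_trans; [apply Cmod_CSeries_le; now apply abs_summable_le with (1 := B)|].
    apply Rle_trans with (Series (fun k => rho * Cmod (z - w)%C * c k)).
    - apply Series_le; [|exact X]. intros k; split; [apply Cmod_ge_0|apply B].
    - rewrite Series_scal_l.
      assert (0 <= rho * Cmod (z - w)%C) by (apply Rmult_le_pos; lra). nra. }
  assert (Z : Cmod (z - w)%C = 0) by nra.
  apply Cmod_eq_0 in Z. replace z with (z - w + w)%C by ring. rewrite Z. ring.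
Qed.

Let den_coef (n : nat) : C := (RtoC (INR n * (1 + lambda * (INR n - 1))) * b n)%C.

Lemma L_den_num_eq_PS (z : C) :
  Cmod z < 1 ->
  abs_conv_disc den_coef 1 /\ abs_conv_disc (fun n => RtoC (INR n) * den_coef n)%C 1 /\
  L_den lambda g z = PS den_coef z /\
  L_num lambda g z = PS (fun n => RtoC (INR n) * den_coef n)%C z.
Proof.
  intros Hz.
  destruct (C_derive_n_eq_PS b 1 g 1 abs_conv_coef hg) as [H1 D1].
  destruct (C_derive_n_eq_PS b 1 g 2 abs_conv_coef hg) as [H2 D2].
  destruct (C_derive_n_eq_PS b 1 g 3 abs_conv_coef hg) as [H3 D3].
  specialize (D1 z Hz). specialize (D2 z Hz). specialize (D3 z Hz).
  change (C_derive g z = PS (shift_derive b) z) in D1.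
  set (d1 := shift_derive b) in *. simpl Nat.iter in H1, H2, H3, D2, D3. fold d1 in H1, H2, H3, D2, D3.
  set (d2 := shift_derive d1) in *. set (d3 := shift_derive d2) in *.
  assert (M1 := abs_conv_disc_mul_z _ _ H1).
  assert (M2 := abs_conv_disc_mul_z _ _ (abs_conv_disc_mul_z _ _ H2)).
  assert (M3 := abs_conv_disc_mul_z _ _ (abs_conv_disc_mul_z _ _ (abs_conv_disc_mul_z _ _ H3))).
  set (m1 := mul_z d1) in *. set (m2 := mul_z (mul_z d2)) in *. set (m3 := mul_z (mul_z (mul_z d3))) in *.
  assert (E1 : (z * PS d1 z)%C = PS m1 z) by (apply PS_mul_z with 1; assumption).
  assert (E2 : (z ^ 2 * PS d2 z)%C = PS m2 z).
  { unfold m2. rewrite <- !PS_mul_z with (rad := 1); try assumption; [simpl; ring|].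
    now apply abs_conv_disc_mul_z. }
  assert (E3 : (z ^ 3 * PS d3 z)%C = PS m3 z).
  { unfold m3. rewrite <- !PS_mul_z with (rad := 1); try assumption; [simpl; ring|..];
    repeat apply abs_conv_disc_mul_z; assumption. }
  (* Small [n] are split off because [mul_z] inserts zeros there; from then on both sides are
     polynomials in n times the same b_n. *)
  assert (F1 : forall n, (m1 n + RtoC lambda * m2 n)%C = den_coef n).
  { intros [|[|n]]; unfold m1, m2, den_coef, d2, d1, mul_z, shift_derive; rewrite ?S_INR;
      repeat (rewrite RtoC_mult || rewrite RtoC_plus || rewrite RtoC_minus); simpl (INR 0); ring. }
  assert (F2 : forall n, (RtoC lambda * m3 n + (RtoC (1 + 2 * lambda) * m2 n + m1 n))%C
                 = (RtoC (INR n) * den_coef n)%C).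
  { intros [|[|[|n]]]; unfold m1, m2, m3, den_coef, d3, d2, d1, mul_z, shift_derive; rewrite ?S_INR;
      repeat (rewrite RtoC_mult || rewrite RtoC_plus || rewrite RtoC_minus); simpl (INR 0); ring. }
  assert (C2 := abs_conv_disc_scal (RtoC lambda) _ _ M2).
  assert (C2' := abs_conv_disc_scal (RtoC (1 + 2 * lambda)) _ _ M2).
  assert (C3 := abs_conv_disc_scal (RtoC lambda) _ _ M3).
  assert (G1 := abs_conv_disc_plus _ _ _ M1 C2).
  assert (G2' := abs_conv_disc_plus _ _ _ C2' M1).
  assert (G2 := abs_conv_disc_plus _ _ _ C3 G2').
  assert (X : forall u v, (forall n, u n = v n) -> abs_conv_disc u 1 -> abs_conv_disc v 1).
  { intros u v Huv Hu r Hr. generalize (Hu r Hr). apply ex_series_ext. intros n. now rewrite Huv. }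
  split; [exact (X _ _ F1 G1)|]. split; [exact (X _ _ F2 G2)|].
  rewrite <- (PS_ext _ _ z F1), <- (PS_ext _ _ z F2).
  rewrite !PS_plus with (rad := 1) by assumption.
  rewrite !PS_scal with (rad := 1) by assumption.
  unfold L_den, L_num. rewrite D1, D2, D3, <- E1, <- E2, <- E3. split; ring.
Qed.

Lemma L_quot_bound (z : C) :
  Cmod z < 1 -> z <> 0%C ->
  L_den lambda g z <> 0%C /\ Re (L_num lambda g z / L_den lambda g z)%C > alpha.
Proof.
  intros Hz Hz0. destruct (L_den_num_eq_PS z Hz) as [H1 [H2 [E1 E2]]].
  set (den := L_den lambda g z) in *. set (num := L_num lambda g z) in *.
  destruct (PS_two_terms _ z H1 Hz) as [S1 T1]. destruct (PS_two_terms _ z H2 Hz) as [S2 T2].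
  rewrite <- E1 in T1. rewrite <- E2 in T2.
  assert (D0 : den_coef 0 = 0%C) by (unfold den_coef; rewrite b0; ring).
  assert (D1 : den_coef 1 = 1%C).
  { unfold den_coef. rewrite b1. simpl INR. replace (1 * (1 + lambda * (1 - 1))) with 1 by ring. ring. }
  rewrite D0, D1 in T1, T2. simpl (INR 0) in T2. simpl (INR 1) in T2.
  set (t := Cmod z) in *. assert (Ht : 0 < t) by now apply Cmod_gt_0.
  set (E := fun k => Cmod (den_coef (k + 2))).
  assert (EW : forall k, (INR k + 2 - alpha) * E k = weight k).
  { intros k. unfold E, weight, den_coef. rewrite Cmod_mult, Cmod_R, plus_INR. simpl (INR 2).
    pose proof (pos_INR k). rewrite Rabs_pos_eq; [ring|]. apply Rmult_le_pos; nra. }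
  assert (PE : forall k, 0 <= E k) by (intros; apply Cmod_ge_0).
  assert (Pt : forall k, 0 <= t ^ (k + 2) <= t ^ 2).
  { intros k. rewrite pow_add. assert (0 <= t ^ k <= 1).
    { split; [apply pow_le; lra|]. rewrite <- (pow1 k). apply pow_incr; lra. }
    assert (0 <= t ^ 2) by apply pow2_ge_0. nra. }
  assert (Sw : ex_series (fun k => t ^ 2 * weight k)) by now apply ex_series_Rmult_l.
  assert (SX : ex_series (fun k => E k * t ^ (k + 2))).
  { apply ex_series_le_nonneg with (2 := Sw). intros k. rewrite <- EW.
    specialize (Pt k). specialize (PE k). pose proof (pos_INR k).
    split; [nra|]. rewrite (Rmult_comm (t ^ 2)). apply Rmult_le_compat; nra. }
  assert (SY : ex_series (fun k => (INR k + 1) * (E k * t ^ (k + 2)))).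
  { apply ex_series_le_nonneg with (2 := Sw). intros k. rewrite <- EW.
    specialize (Pt k). specialize (PE k). pose proof (pos_INR k).
    split; [apply Rmult_le_pos; nra|]. rewrite (Rmult_comm (t ^ 2)), <- Rmult_assoc.
    apply Rmult_le_compat; nra. }
  set (X := Series (fun k => E k * t ^ (k + 2))) in *.
  set (Y := Series (fun k => (INR k + 1) * (E k * t ^ (k + 2)))) in *.
  (* Strictness enters here, through t^2 < t. With |num - den| <= Y and |den| >= t - X this gives Y
     < (1 - alpha) |den|. *)
  assert (XY : Y + (1 - alpha) * X < (1 - alpha) * t).
  { assert (Y + (1 - alpha) * X <= t ^ 2 * Series weight).
    { unfold X, Y. rewrite <- !Series_scal_l.
      rewrite <- Series_plus by (try apply ex_series_Rmult_l; assumption).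
      apply Series_le; [|exact Sw]. intros k. rewrite <- EW.
      specialize (Pt k). specialize (PE k). pose proof (pos_INR k).
      replace ((INR k + 1) * (E k * t ^ (k + 2)) + (1 - alpha) * (E k * t ^ (k + 2)))
        with ((INR k + 2 - alpha) * E k * t ^ (k + 2)) by ring.
      assert (0 <= (INR k + 2 - alpha) * E k) by (apply Rmult_le_pos; lra).
      split; [apply Rmult_le_pos; lra|]. rewrite (Rmult_comm (t ^ 2)). apply Rmult_le_compat_l; lra. }
    assert (t ^ 2 * Series weight <= t ^ 2 * (1 - alpha))
      by (apply Rmult_le_compat_l; [apply pow2_ge_0|exact hsum]).
    assert (t ^ 2 < t) by (simpl; nra).
    assert ((1 - alpha) * t ^ 2 < (1 - alpha) * t) by (apply Rmult_lt_compat_l; lra).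
    lra. }
  assert (BX : Cmod (den - z)%C <= X).
  { replace (den - z)%C with (CSeries (fun k => den_coef (k + 2)%nat * z ^ (k + 2)))%C
      by (rewrite T1; ring).
    eapply Rle_trans; [now apply Cmod_CSeries_le|]. unfold X. right. apply Series_ext.
    intros k. now rewrite Cmod_mult, Cmod_pow. }
  assert (BY : Cmod (num - den)%C <= Y).
  { replace (num - den)%C with (CSeries (fun k => RtoC (INR (k + 2)) * den_coef (k + 2)%nat * z ^ (k + 2)
        - den_coef (k + 2)%nat * z ^ (k + 2)))%C.
    - assert (Sm : abs_summable (fun k => RtoC (INR (k + 2)) * den_coef (k + 2)%nat * z ^ (k + 2)
        - den_coef (k + 2)%nat * z ^ (k + 2))%C).
      { apply (abs_summable_ext (fun k => RtoC (INR (k + 2)) * den_coef (k + 2)%nat * z ^ (k + 2)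
        + RtoC (-1) * (den_coef (k + 2)%nat * z ^ (k + 2)))%C); [intros; ring|].
        apply abs_summable_plus; [exact S2|now apply abs_summable_scal]. }
      eapply Rle_trans; [now apply Cmod_CSeries_le|]. unfold Y. right. apply Series_ext.
      intros k.
      replace (RtoC (INR (k + 2)) * den_coef (k + 2)%nat * z ^ (k + 2)
        - den_coef (k + 2)%nat * z ^ (k + 2))%C
        with (RtoC (INR k + 1) * (den_coef (k + 2)%nat * z ^ (k + 2)))%C
        by (rewrite plus_INR, !RtoC_plus; simpl (INR 2); rewrite RtoC_plus; ring).
      rewrite !Cmod_mult, Cmod_pow, Cmod_R, Rabs_pos_eq by (pose proof (pos_INR k); lra).
      reflexivity.
    - rewrite CSeries_minus by assumption. rewrite T1, T2. ring. }
  assert (Bd : t - X <= Cmod den).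
  { pose proof (Cmod_triangle den (- (den - z))%C) as T. rewrite Cmod_opp in T.
    replace (den + - (den - z))%C with z in T by ring. fold t in T. lra. }
  assert (Y0 : 0 <= Y) by (eapply Rle_trans; [apply Cmod_ge_0|exact BY]).
  (* Non-vanishing is a by-product: 0 <= Y < (1 - alpha) (t - X) forces t - X > 0. *)
  assert (Pd : 0 < Cmod den) by nra.
  assert (Nd : den <> 0%C) by now apply Cmod_gt_0.
  split; [exact Nd|].
  replace (num / den)%C with (1 + (num - den) / den)%C by (field; exact Nd).
  rewrite Re_plus. change (Re 1%C) with 1.
  pose proof (re_le_Cmod ((num - den) / den)%C) as Rd. rewrite Cmod_div in Rd by exact Nd.
  assert (Q : Cmod (num - den)%C / Cmod den < 1 - alpha).
  { apply Rmult_lt_reg_r with (Cmod den); [exact Pd|].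
    unfold Rdiv. rewrite Rmult_assoc, Rinv_l by lra. nra. }
  apply Rabs_le_between in Rd. lra.
Qed.

Lemma class_L_of_coef_bound : class_L lambda alpha g.
Proof.
  pose proof abs_conv_coef as Hb.
  split; [split; [|split; [|split]]|].
  - intros z Hz. eexists. now apply is_derive_eq_PS with (a := b) (rad := 1).
  - apply coef_univalent.
  - rewrite hg by (rewrite Cmod_0; lra). rewrite (PS_0 b 1) by (lra || assumption). exact b0.
  - assert (H0 : Cmod 0 < 1) by (rewrite Cmod_0; lra).
    rewrite (is_C_derive_unique _ _ _ (is_derive_eq_PS b 1 g 0%C Hb hg H0)).
    rewrite (PS_0 _ 1 Rlt_0_1 (abs_conv_disc_derive _ _ Hb)).
    unfold shift_derive. rewrite b1. simpl INR. ring.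
  - intros z Hz. unfold L_quot. destruct (Ceq_dec z 0%C) as [->|Hz0].
    + split; [now intros []|]. change (1 > alpha). lra.
    + destruct (L_quot_bound z Hz Hz0) as [N Q]. now split.
Qed.

End Coefficient_criterion.

(** * The Bessel-Struve coefficients *)

Lemma bs_coef_0 (nu : R) : - (1 / 2) < nu -> bs_coef nu 0 = 1.
Proof.
  intros Hnu. unfold bs_coef. simpl INR. simpl fact.
  replace ((0 + 1) / 2) with (1 / 2) by field.
  replace (0 / 2 + nu + 1) with (nu + 1) by field.
  rewrite Gamma_half. pose proof (Gamma_pos (nu + 1) ltac:(lra)).
  pose proof (sqrt_lt_R0 PI PI_RGT_0). simpl. field. lra.
Qed.

Lemma bs_coef_nonneg (nu : R) (n : nat) : - (1 / 2) < nu -> 0 <= bs_coef nu n.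
Proof.
  intros Hnu. unfold bs_coef. pose proof (pos_INR n).
  pose proof (Gamma_pos (nu + 1) ltac:(lra)).
  pose proof (Gamma_pos ((INR n + 1) / 2) ltac:(lra)).
  pose proof (Gamma_pos (INR n / 2 + nu + 1) ltac:(lra)).
  pose proof (sqrt_lt_R0 PI PI_RGT_0). pose proof (INR_fact_lt_0 n).
  apply Rlt_le, Rdiv_lt_0_compat; repeat apply Rmult_lt_0_compat; assumption.
Qed.

(** Since nu > -1/2, the numerator argument (n + 1)/2 lies below the denominator argument y.
    [Gamma_quasi_increasing] and the lower bound m <= Gamma y then give Gamma((n + 1)/2) <= (1 +
    Gamma(1/2)/m) Gamma y. *)
Lemma bs_coef_bound (nu : R) :
  - (1 / 2) < nu -> exists K, 0 <= K /\ forall n, bs_coef nu n <= K * / INR (fact n).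
Proof.
  intros Hnu. set (m := exp (- 2) / 2).
  assert (Hm : 0 < m) by (unfold m; pose proof (exp_pos (- 2)); lra).
  pose proof (Gamma_pos (nu + 1) ltac:(lra)) as G0.
  pose proof (Gamma_pos (1 / 2) ltac:(lra)) as Gh.
  pose proof (sqrt_lt_R0 PI PI_RGT_0) as Hs.
  assert (Hq : 0 < 1 + Gamma (1 / 2) / m).
  { assert (0 < Gamma (1 / 2) / m) by now apply Rdiv_lt_0_compat. lra. }
  exists (Gamma (nu + 1) / sqrt PI * (1 + Gamma (1 / 2) / m)). split.
  - apply Rlt_le, Rmult_lt_0_compat; [now apply Rdiv_lt_0_compat|exact Hq].
  - intros n. pose proof (pos_INR n). unfold bs_coef.
    set (y := INR n / 2 + nu + 1).
    pose proof (Gamma_quasi_increasing ((INR n + 1) / 2) y ltac:(lra) ltac:(unfold y; lra)) as Q.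
    pose proof (Gamma_lower_bound y ltac:(unfold y; lra)) as L. fold m in L.
    assert (Q2 : Gamma ((INR n + 1) / 2) <= (1 + Gamma (1 / 2) / m) * Gamma y).
    { assert (Gamma (1 / 2) <= Gamma (1 / 2) / m * Gamma y); [|lra].
      replace (Gamma (1 / 2)) with (Gamma (1 / 2) / m * m) at 1 by (field; lra).
      apply Rmult_le_compat_l; [apply Rlt_le; now apply Rdiv_lt_0_compat|exact L]. }
    pose proof (INR_fact_lt_0 n) as Hf.
    apply Rmult_le_reg_r with (sqrt PI * INR (fact n) * Gamma y).
    { repeat apply Rmult_lt_0_compat; lra. }
    replace (Gamma (nu + 1) * Gamma ((INR n + 1) / 2) / (sqrt PI * INR (fact n) * Gamma y)
       * (sqrt PI * INR (fact n) * Gamma y)) with (Gamma (nu + 1) * Gamma ((INR n + 1) / 2))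
      by (field; lra).
    replace (Gamma (nu + 1) / sqrt PI * (1 + Gamma (1 / 2) / m) * / INR (fact n)
       * (sqrt PI * INR (fact n) * Gamma y))
      with (Gamma (nu + 1) * ((1 + Gamma (1 / 2) / m) * Gamma y)) by (field; lra).
    apply Rmult_le_compat_l; lra.
Qed.

Lemma abs_conv_bs_coef (nu rad : R) :
  - (1 / 2) < nu -> abs_conv_disc (fun n => RtoC (bs_coef nu n)) rad.
Proof.
  intros Hnu r Hr. destruct (bs_coef_bound nu Hnu) as [K [HK HB]].
  apply ex_series_le_nonneg with (fun n => K * (/ INR (fact n) * r ^ n)).
  - intros n. rewrite Cmod_R, Rabs_pos_eq by now apply bs_coef_nonneg.
    assert (0 <= r ^ n) by (apply pow_le; lra). pose proof (bs_coef_nonneg nu n Hnu).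
    split; [now apply Rmult_le_pos|]. rewrite <- Rmult_assoc. now apply Rmult_le_compat_r.
  - apply ex_series_Rmult_l. exists (exp r). apply is_pseries_R. apply is_exp_Reals.
Qed.

Lemma Re_PS_RtoC_1 (c : nat -> R) : Re (PS (fun n => RtoC (c n)) 1%C) = Series c.
Proof.
  apply Series_ext. intros n.
  rewrite Cpow_1_l, Cmult_1_r. reflexivity.
Qed.

Lemma ex_series_of_abs_conv (c : nat -> R) (rad : R) :
  1 < rad -> abs_conv_disc (fun n => RtoC (c n)) rad -> ex_series c.
Proof.
  intros Hr H. apply ex_series_Rabs. specialize (H 1 ltac:(lra)). revert H.
  apply ex_series_ext. intros n. rewrite pow1, Cmod_R. apply Rmult_1_r.
Qed.

Lemma shift_derive_RtoC (c : nat -> R) (n : nat) :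
  shift_derive (fun k => RtoC (c k)) n = RtoC (INR (S n) * c (S n)).
Proof. unfold shift_derive. now rewrite RtoC_mult. Qed.

(** With m = k + 1 the weight splits as (m + 1 - alpha)(1 + lambda m) = lambda m (m - 1) + (1 -
    lambda alpha + 2 lambda) m + (1 - alpha), which matches S_nu'', S_nu' and S_nu - 1 at 1. *)
Lemma bessel_struve_weighted_sum (nu alpha lambda : R) :
  - (1 / 2) < nu ->
  is_series (fun k => (INR k + 2 - alpha) * (1 + lambda * (INR k + 1)) * bs_coef nu (k + 1))
    (lambda * Re (C_derive_n (bessel_struve nu) 2 1%C)
     + (1 - lambda * alpha + 2 * lambda) * Re (C_derive (bessel_struve nu) 1%C)
     + (1 - alpha) * (Re (bessel_struve nu 1%C) - 1)).
Proof.
  intros Hnu. set (c := bs_coef nu). set (cc := fun n => RtoC (c n)).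
  (* Any radius above 1 would do; it makes 1 an interior point, where termwise differentiation
     applies. *)
  pose proof (abs_conv_bs_coef nu 2 Hnu) as H0.
  assert (H1 := abs_conv_disc_derive _ _ H0). assert (H2 := abs_conv_disc_derive _ _ H1).
  assert (L : Cmod 1 < 2) by (rewrite Cmod_1; lra).
  destruct (C_derive_n_eq_PS cc 2 (bessel_struve nu) 2 H0 (fun y _ => eq_refl)) as [_ D2].
  destruct (C_derive_n_eq_PS cc 2 (bessel_struve nu) 1 H0 (fun y _ => eq_refl)) as [_ D1].
  specialize (D1 _ L). specialize (D2 _ L).
  change (C_derive_n (bessel_struve nu) 1 1%C) with (C_derive (bessel_struve nu) 1%C) in D1.
  simpl Nat.iter in D1, D2.
  set (c1 := fun n => INR (S n) * c (S n)). set (c2 := fun n => INR (S n) * c1 (S n)).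
  assert (E1 : forall n, shift_derive cc n = RtoC (c1 n)) by (intros; apply shift_derive_RtoC).
  assert (E2 : forall n, shift_derive (shift_derive cc) n = RtoC (c2 n)).
  { intros n. unfold shift_derive at 1. rewrite E1. unfold c2. now rewrite RtoC_mult. }
  rewrite D1, D2, (PS_ext _ _ _ E1), (PS_ext _ _ _ E2), !Re_PS_RtoC_1.
  change (Re (bessel_struve nu 1%C)) with (Re (PS cc 1%C)). unfold cc. rewrite Re_PS_RtoC_1.
  assert (X : forall u v, (forall n, u n = v n) -> abs_conv_disc u 2 -> abs_conv_disc v 2).
  { intros u v Huv Hu r Hr. generalize (Hu r Hr). apply ex_series_ext. intros n. now rewrite Huv. }
  assert (S0 : ex_series c) by (apply ex_series_of_abs_conv with 2; [lra|exact H0]).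
  assert (S1 : ex_series c1) by (apply ex_series_of_abs_conv with 2; [lra|exact (X _ _ E1 H1)]).
  assert (S2 : ex_series c2) by (apply ex_series_of_abs_conv with 2; [lra|exact (X _ _ E2 H2)]).
  assert (T0 : is_series (fun k => c (k + 1)%nat) (Series c - 1)).
  { replace (Series c - 1) with (Series (fun k => c (S k))).
    - apply is_series_ext with (fun k => c (S k)).
      + intros k. now rewrite Nat.add_1_r.
      + apply Series_correct. now apply (ex_series_incr_1 (K:=R_AbsRing) (V:=R_NormedModule) c).
    - rewrite (Series_incr_1 c S0). unfold c at 2. rewrite bs_coef_0 by exact Hnu. ring. }
  (* The series of S_nu''(1) starts at m = 2, the other two at m = 1; the prepended zero aligns the
     indices. *)
  set (d2 := fun k => match k with O => 0 | S j => c2 j end).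
  assert (T2 : is_series d2 (Series c2)).
  { assert (Sd : ex_series d2) by now apply (ex_series_incr_1 (K:=R_AbsRing) (V:=R_NormedModule) d2).
    replace (Series c2) with (Series d2) by (rewrite (Series_incr_1 d2 Sd); simpl; apply Rplus_0_l).
    now apply Series_correct. }
  pose proof (Series_correct _ S1) as T1.
  pose proof (is_series_scal lambda _ _ T2) as U2.
  pose proof (is_series_scal (1 - lambda * alpha + 2 * lambda) _ _ T1) as U1.
  pose proof (is_series_scal (1 - alpha) _ _ T0) as U0.
  pose proof (is_series_plus _ _ _ _ (is_series_plus _ _ _ _ U2 U1) U0) as U.
  revert U. apply is_series_ext. intros k.
  change (lambda * d2 k + (1 - lambda * alpha + 2 * lambda) * c1 k + (1 - alpha) * c (k + 1)%nat
    = (INR k + 2 - alpha) * (1 + lambda * (INR k + 1)) * c (k + 1)%nat).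
  rewrite Nat.add_1_r. unfold d2, c2, c1. destruct k as [|k].
  - simpl INR. ring.
  - rewrite !S_INR. ring.
Qed.

(* Applied to f'(z) - 1 in the notation of coef_bound, whose constant is c = (A - B) tau. *)
Lemma class_R_coef_bound (tau : C) (A B : R) (f : C -> C) :
  tau <> 0%C -> -1 <= B -> B < A -> A <= 1 -> class_R tau A B f ->
  exists a : nat -> C,
    (forall n, taylor_coef f n = a n) /\
    forall k, (INR k + 2) * Cmod (a (k + 2)%nat) <= (A - B) * Cmod tau.
Proof.
  intros Ht HB HBA HA [_ [[a [a0 [a1 Ha]]] HR]].
  destruct (abs_conv_disc_of_converges a f 1 Ha) as [Hc Hf].
  exists a. split; [intros n; now apply taylor_coef_eq_PS with 1; [lra|..]|].
  intros k.
  (* The coefficients of f' - 1: as a_1 = 1, subtracting 1 amounts to setting the constant term to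
     0. *)
  set (w := fun n => match n return C with O => 0%C | S _ => shift_derive a n end).
  assert (Hc1 := abs_conv_disc_derive _ _ Hc).
  assert (Hw : abs_conv_disc w 1).
  { intros r Hr. apply (ex_series_incr_1 (K:=R_AbsRing) (V:=R_NormedModule)).
    generalize (Hc1 r Hr). apply (ex_series_incr_1 (K:=R_AbsRing) (V:=R_NormedModule)). }
  assert (D : forall z, Cmod z < 1 -> PS w z = (C_derive f z - 1)%C).
  { intros z Hz. rewrite (is_C_derive_unique _ _ _ (is_derive_eq_PS a 1 f z Hc Hf Hz)).
    unfold PS. rewrite (CSeries_incr_1 _ (abs_conv_disc_summable _ _ _ Hw Hz)).
    rewrite (CSeries_incr_1 _ (abs_conv_disc_summable _ _ _ Hc1 Hz)).
    unfold w, shift_derive at 2. rewrite a1. simpl INR. simpl (_ ^ 0)%C. ring. }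
  set (c := (RtoC (A - B) * tau)%C).
  assert (Nc : c <> 0%C).
  { apply Cmod_gt_0. unfold c. rewrite Cmod_mult, Cmod_R, Rabs_pos_eq by lra.
    apply Rmult_lt_0_compat; [lra|now apply Cmod_gt_0]. }
  (* The index drops by one under differentiation: w_(k+1) = (k + 2) a_(k+2). *)
  assert (Bd : Cmod (w (k + 1)%nat) <= Cmod c).
  { apply (coef_bound w c B (k + 1) Hw eq_refl Nc ltac:(lra) ltac:(lia)).
    intros z Hz. rewrite (D z Hz). destruct (HR z Hz) as [Nd Q]. fold c in Nd, Q.
    rewrite Cmod_div in Q by exact Nd. apply Cmod_gt_0 in Nd.
    apply Rmult_lt_compat_r with (r := Cmod (c - B * (C_derive f z - 1))%C) in Q; [|exact Nd].
    unfold Rdiv in Q. rewrite Rmult_assoc, Rinv_l in Q by lra. lra. }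
  rewrite Nat.add_1_r in Bd. unfold w, shift_derive, c in Bd.
  rewrite !Cmod_mult, !Cmod_R, !Rabs_pos_eq in Bd by (apply pos_INR || lra).
  rewrite !S_INR in Bd. replace (k + 2)%nat with (S (S k)) by lia. lra.
Qed.

Theorem theorem2p3 (nu alpha lambda : R) (tau : C) (A B : R) (f : C -> C)
  (hnu : - (1 / 2) < nu)
  (halpha : 0 <= alpha < 1) (hlambda : 0 <= lambda < 1)
  (htau : tau <> 0%C)
  (hB : -1 <= B) (hBA : B < A) (hA : A <= 1)
  (hf : class_R tau A B f)
  (hS : (A - B) * Cmod tau *
        (lambda * Re (C_derive_n (bessel_struve nu) 2 1%C)
         + (1 - lambda * alpha + 2 * lambda) * Re (C_derive (bessel_struve nu) 1%C)
         + (1 - alpha) * (Re (bessel_struve nu 1%C) - 1)) <= 1 - alpha) :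
  class_L lambda alpha (J_op nu f).
Proof.
  destruct (class_R_coef_bound tau A B f htau hB hBA hA hf) as [a [Ea Ba]].
  pose proof (bessel_struve_weighted_sum nu alpha lambda hnu) as T.
  set (s := fun k => (INR k + 2 - alpha) * (1 + lambda * (INR k + 1)) * bs_coef nu (k + 1)) in T.
  rewrite <- (is_series_unique _ _ T), <- Series_scal_l in hS.
  assert (Sx : ex_series (fun k => (A - B) * Cmod tau * s k))
    by (apply ex_series_Rmult_l; eexists; exact T).
  (* The coefficients of J_nu f; for n = k + 2 the factor c_(n-1)(nu) is [bs_coef nu (k + 1)]. *)
  set (b := fun n => match n return C with
              | O => 0%C | 1%nat => 1%C
              | S (S k) => (bs_coef nu (k + 1) * a n)%C end).
  (* The bound n |a_n| <= (A - B) |tau| absorbs the factor n of the weight, so the criterion's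
     series is dominated term by term by the one in [hS]. *)
  assert (W : forall k, 0 <= (INR k + 2 - alpha) *
       ((INR k + 2) * (1 + lambda * (INR k + 1)) * Cmod (b (k + 2)%nat)) <= (A - B) * Cmod tau * s k).
  { intros k. pose proof (pos_INR k) as Pk. unfold s.
    replace (b (k + 2)%nat) with (bs_coef nu (k + 1) * a (k + 2)%nat)%C
      by (replace (k + 2)%nat with (S (S k)) by lia; reflexivity).
    pose proof (bs_coef_nonneg nu (k + 1) hnu) as Pc.
    rewrite Cmod_mult, Cmod_R, Rabs_pos_eq by exact Pc.
    assert (0 <= 1 + lambda * (INR k + 1)) by nra.
    assert (0 <= (INR k + 2 - alpha) * (1 + lambda * (INR k + 1)) * bs_coef nu (k + 1))
      by (apply Rmult_le_pos; [apply Rmult_le_pos; lra|exact Pc]).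
    replace ((INR k + 2 - alpha) * ((INR k + 2) * (1 + lambda * (INR k + 1))
        * (bs_coef nu (k + 1) * Cmod (a (k + 2)%nat))))
      with ((INR k + 2) * Cmod (a (k + 2)%nat)
        * ((INR k + 2 - alpha) * (1 + lambda * (INR k + 1)) * bs_coef nu (k + 1))) by ring.
    split.
    - apply Rmult_le_pos; [apply Rmult_le_pos; [lra|apply Cmod_ge_0]|assumption].
    - apply Rmult_le_compat_r; [assumption|apply Ba]. }
  assert (Wx := ex_series_le_nonneg _ _ W Sx).
  assert (Ws := Rle_trans _ _ _ (Series_le _ _ W Sx) hS).
  apply (class_L_of_coef_bound alpha lambda b _ halpha (proj1 hlambda) eq_refl eq_refl); [|exact Wx|exact Ws].
  intros z Hz.
  pose proof (abs_conv_coef alpha lambda b halpha (proj1 hlambda) Wx) as Hb.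
  destruct (PS_two_terms b z Hb Hz) as [_ E].
  rewrite E. unfold J_op. rewrite (CSeries_ext _ (fun k => b (k + 2)%nat * z ^ (k + 2))%C).
  - simpl b. ring.
  - intros k. rewrite Ea. replace (k + 2)%nat with (S (S k)) by lia. reflexivity.
Qed.
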